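(* For any constants $d\in\mathbb{N}$ and $\zeta>0$ there exist $\epsilon_0,n_0$ depending only on $d,\zeta$ such that the following holds. Suppose that $n>n_0$, that $\zeta n\le k\le\frac{d-1}{d}n$, and that $\mathcal{F}\subseteq\binom{[n]}{k}$ is a family that does not contain a $d$-simplex and satisfies $|\mathcal{F}|\ge(1-\epsilon_0)\binom{n-1}{k-1}$. Then $\mathcal{F}$ is contained in a $(1,1)$-star, i.e. there is $i\in[n]$ with $i\in A$ for all $A\in\mathcal{F}$.
   Context: A $d$-simplex is a family of $d+1$ sets whose intersection is empty but such that any $d$ of them have nonempty intersection. *)

(* Defs.v *)
From mathcomp Require Import all_boot all_order all_algebra.
From mathcomp Require Import reals.

Set Implicit Arguments.
Unset Strict Implicit.
Unset Printing Implicit Defensive.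

(* For [0 < d], members indexed with repetition would give the same notion:
   two equal members would make the full intersection an intersection of d
   members, hence nonempty. *)
Definition is_simplex (T : finType) (d : nat) (S : {set {set T}}) : Prop :=
  [/\ #|S| = d.+1,
      \bigcap_(A in S) A = set0
    & forall S' : {set {set T}}, S' \subset S -> #|S'| = d ->
        \bigcap_(A in S') A != set0].

Definition contains_simplex (T : finType) (d : nat) (F : {set {set T}}) : Prop :=
  exists2 S : {set {set T}}, S \subset F & is_simplex d S.

Definition uniform (T : finType) (k : nat) (F : {set {set T}}) : Prop :=
  forall A : {set T}, A \in F -> #|A| = k.

(* Main.v *)
(* Write q = d / (d + 1), and replace a family by the function "contains a
   member" on the cube {0,1}^n with a product measure mu_p.

   Fixing the traces of the members on a set W of d + 1 points, with W minus w
   for the w-th family, turns a d-simplex-free family into d + 1 families such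
   that members taken one from each have a common point outside W.  A random
   (d + 1)-colouring of the remaining points shows that their up-closures
   satisfy sum_w mu_q <= d, while mu_p >= (1 - eps) p for every p between k/n
   and q, as mu_(p^t) <= (mu_p)^t for t >= 1.  So for one such p just below q
   the up-closure f has mu_p(f) close to p and, by Russo's formula and the mean
   value theorem, total influence at most about 1.  The Poincare inequality with
   a gap, 2 var <= p (1 - p) (sum_i I_i + sum_i I_i^2), then forces an influence
   close to 1: almost every member with the given trace contains a fixed point
   i.  The set W can be chosen inside any large set, because all but boundedly
   many points have almost the expected degree in a dense family.

   Finally, if B is a member missing i, then W may be chosen disjoint from B,
   and d random members of the star at i with prescribed traces on d points of
   B complete B to a d-simplex. *)
Require Import Defs.
From mathcomp Require Import all_classical all_reals topology normedtype derive.
From mathcomp Require Import interval_inference exp convex hoelder realfun.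
From mathcomp Require Import all_boot all_order all_algebra all_fingroup.
From mathcomp Require Import ring lra zify.

Set Implicit Arguments.
Unset Strict Implicit.
Unset Printing Implicit Defensive.

Import Order.TTheory GRing.Theory Num.Theory.
Import numFieldNormedType.Exports.
Local Open Scope ring_scope.

(** * Averages over the biased cube *)

Section Cube.
Variables (R : realType) (T : finType).
Implicit Types (p : R) (s : seq T) (f g : {set T} -> R) (A B : {set T}).

(** The hypothesis on k enters twice. It keeps k / n at most (d - 1) / d, below q by a constant,
    which is needed because density is transported only upwards from k / n towards q; and d (n - k)
    >= n says that d complements of k-sets can cover the ground set, which the final simplex needs.
    The traces W minus w supply, for every choice of d of the d + 1 members, a common point inside
    W; only the emptiness of the full intersection is left to arrange outside W. The value q is the
    one where the two bounds meet: (d + 1) q = d, so each of the d + 1 measures is squeezed around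
    q, and the average slope just below q is about 1, as for the family of all sets containing i.
    The point i found in this way belongs to one set W, while a member B missing i is known only
    after i. A second set, avoiding B, i and W, must therefore be shown to have the same centre.
    This is why traces have to be dense on the union of the two sets. *)

Definition avg1 p (i : T) f A : R := p * f (i |: A) + (1 - p) * f (A :\ i).

(* Expectation of [f] at the random set obtained from [A] by resampling every
   coordinate in [s], each being present with probability [p]. *)
Fixpoint avg p s f A : R :=
  if s is i :: s' then avg1 p i (avg p s' f) A else f A.

Definition dif (i : T) f A : R := f (i |: A) - f (A :\ i).

Definition var p s f A : R := avg p s (fun B => f B ^+ 2) A - avg p s f A ^+ 2.

Definition nondec f := forall A B, A \subset B -> f A <= f B.

Lemma avg_cons p i s f A :
  avg p (i :: s) f A = p * avg p s f (i |: A) + (1 - p) * avg p s f (A :\ i).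
Proof. by []. Qed.

Lemma eq_avg p s f g A : f =1 g -> avg p s f A = avg p s g A.
Proof. by move=> fg; elim: s A => [|i s IH] A /=; rewrite ?fg // /avg1 !IH. Qed.

Lemma avgD p s f g A :
  avg p s (fun B => f B + g B) A = avg p s f A + avg p s g A.
Proof. by elim: s A => [//|i s IH] A; rewrite !avg_cons !IH; ring. Qed.

Lemma avgZ p s c f A : avg p s (fun B => c * f B) A = c * avg p s f A.
Proof. by elim: s A => [//|i s IH] A; rewrite !avg_cons !IH; ring. Qed.

Lemma avg_cst p s c A : avg p s (fun=> c) A = c.
Proof. by elim: s A => [//|i s IH] A; rewrite !avg_cons !IH; ring. Qed.

Lemma avgB p s f g A :
  avg p s (fun B => f B - g B) A = avg p s f A - avg p s g A.
Proof. by elim: s A => [//|i s IH] A; rewrite !avg_cons !IH; ring. Qed.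

Lemma avg_sum p s (I : Type) (r : seq I) (P : pred I)
    (F : I -> {set T} -> R) A :
  avg p s (fun B => \sum_(j <- r | P j) F j B) A =
  \sum_(j <- r | P j) avg p s (F j) A.
Proof.
elim: r => [|j r IH].
  rewrite big_nil -[RHS](avg_cst p s 0 A).
  by apply: eq_avg => B; rewrite big_nil.
rewrite big_cons -IH; case: ifP => Pj.
  by rewrite -avgD; apply: eq_avg => B; rewrite big_cons Pj.
by apply: eq_avg => B; rewrite big_cons Pj.
Qed.

Lemma le_avg p s f g A : 0 <= p <= 1 ->
    (forall B, B \subset A :|: [set x in s] -> f B <= g B) ->
  avg p s f A <= avg p s g A.
Proof.
move=> /andP[p0 p1]; elim: s A => [|i s IH] A fg.
  by apply: fg; apply: subsetUl.
rewrite !avg_cons; apply: lerD; apply: ler_wpM2l; rewrite ?subr_ge0 //.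
  apply: IH => B sB; apply: fg; apply: subset_trans sB _.
  by apply/subsetP => x; rewrite !inE; case: (x == i); rewrite ?orbT.
apply: IH => B sB; apply: fg; apply: subset_trans sB _.
by apply/subsetP => x; rewrite !inE; case: (x == i) => //=; rewrite orbT.
Qed.

Lemma avg_ge0 p s f A : 0 <= p <= 1 -> (forall B, 0 <= f B) ->
  0 <= avg p s f A.
Proof. by move=> p01 f0; rewrite -(avg_cst p s 0 A); apply: le_avg. Qed.

Lemma avg_le1 p s f A : 0 <= p <= 1 -> (forall B, f B <= 1) ->
  avg p s f A <= 1.
Proof. by move=> p01 f0; rewrite -(avg_cst p s 1 A); apply: le_avg. Qed.

Lemma setU1CA i j A : i |: (j |: A) = j |: (i |: A).
Proof. exact: setUCA. Qed.

Lemma setU1D1 i j A : i != j -> i |: (A :\ j) = (i |: A) :\ j.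
Proof.
move=> ij; apply/setP => x; rewrite !inE.
by case: (eqVneq x i) => [->|]; rewrite ?ij.
Qed.

Lemma setD1CA i j A : A :\ i :\ j = A :\ j :\ i.
Proof. by apply/setP => x; rewrite !inE andbCA. Qed.

Lemma setU1U1 i A : i |: (i |: A) = i |: A.
Proof. by rewrite setUA setUid. Qed.

Lemma setU1D1id i A : i |: (A :\ i) = i |: A.
Proof. by apply/setP => x; rewrite !inE; case: eqP. Qed.

Lemma setD1U1id i A : (i |: A) :\ i = A :\ i.
Proof. by apply/setP => x; rewrite !inE; case: eqP. Qed.

Lemma setD1D1 i A : A :\ i :\ i = A :\ i.
Proof. by apply/setP => x; rewrite !inE andbA andbb. Qed.

Lemma dif_avg p s i f A : i \notin s ->
  avg p s (dif i f) A = dif i (avg p s f) A.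
Proof.
elim: s A => [//|j s IH] A; rewrite inE negb_or => /andP[ij iNs].
rewrite /dif !avg_cons !IH // /dif setU1CA -!setU1D1 //; last by rewrite eq_sym.
by rewrite (setD1CA i j); ring.
Qed.

Lemma dif_dif i j f A : dif i (dif j f) A = dif j (dif i f) A.
Proof.
have [->//|ij] := eqVneq i j.
rewrite /dif (setU1CA i j) -!setU1D1 ?(setD1CA i j) // 1?eq_sym //.
by ring.
Qed.

Lemma dif_U1 i f A : dif i f (i |: A) = dif i f A.
Proof. by rewrite /dif setU1U1 setD1U1id. Qed.

Lemma dif_D1 i f A : dif i f (A :\ i) = dif i f A.
Proof. by rewrite /dif setU1D1id setD1D1. Qed.

Lemma avg_dif_U1 p s i f A : i \notin s ->
  avg p s (dif i f) (i |: A) = avg p s (dif i f) A.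
Proof. by move=> iNs; rewrite !dif_avg // dif_U1. Qed.

Lemma avg_dif_D1 p s i f A : i \notin s ->
  avg p s (dif i f) (A :\ i) = avg p s (dif i f) A.
Proof. by move=> iNs; rewrite !dif_avg // dif_D1. Qed.

Lemma avg_fixed p s i f A : i \notin s ->
    (forall B, f (i |: B) = f B) -> (forall B, f (B :\ i) = f B) ->
  avg p s f (i |: A) = avg p s f A /\ avg p s f (A :\ i) = avg p s f A.
Proof.
move=> iNs fU fD; elim: s iNs A => [//|j s IH].
rewrite inE negb_or => /andP[ij iNs] A; rewrite !avg_cons.
have [-> ->] : avg p s f (j |: (i |: A)) = avg p s f (j |: A) /\
  avg p s f ((i |: A) :\ j) = avg p s f (A :\ j).
  by rewrite setU1CA -setU1D1 // !(IH iNs _).1.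
rewrite (setD1CA i j) (IH iNs _).2 setU1D1 1?eq_sym //.
by rewrite (IH iNs _).2.
Qed.

Lemma avg_cons_dif p i s f A : i \notin s ->
  avg p (i :: s) f A = avg p s f (A :\ i) + p * avg p s (dif i f) A.
Proof. by move=> iNs; rewrite avg_cons dif_avg // /dif; ring. Qed.

Lemma nondec_dif_ge0 i f A : nondec f -> 0 <= dif i f A.
Proof.
move=> ndf; rewrite subr_ge0; apply: ndf.
by apply: subset_trans (subsetUr _ _); apply: subD1set.
Qed.

Lemma avg_nondec p s f : 0 <= p <= 1 -> nondec f -> nondec (avg p s f).
Proof.
move=> /andP[p0 p1] ndf; elim: s => [//|i s IH] A B AB.
rewrite !avg_cons; apply: lerD; apply: ler_wpM2l; rewrite ?subr_ge0 //.
  by apply: IH; apply: setUS.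
by apply: IH; apply: setSD.
Qed.

(** Law of total variance: the two conditional means differ by the average of [dif i f], and a
    two-point variable with weights p and 1 - p has variance p (1 - p) times the squared gap. *)
Lemma var_cons p i s f A : i \notin s ->
  var p (i :: s) f A = p * var p s f (i |: A) + (1 - p) * var p s f (A :\ i)
    + p * (1 - p) * avg p s (dif i f) A ^+ 2.
Proof. by move=> iNs; rewrite dif_avg // /var !avg_cons /dif; ring. Qed.

(** Bessel's inequality: up to the factor sqrt (p (1 - p)), the average of [dif j f] is the Fourier
    coefficient at {j}. In the induction the new coordinate contributes its square exactly, the old
    ones through convexity of squaring. *)
Lemma level1_le_var p s f A : 0 <= p <= 1 -> uniq s ->
  p * (1 - p) * \sum_(j <- s) avg p s (dif j f) A ^+ 2 <= var p s f A.
Proof.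
move=> /andP[p0 p1]; elim: s A => [|i s IH] A.
  by rewrite big_nil mulr0 /var subrr.
rewrite cons_uniq => /andP[iNs us]; rewrite var_cons // big_cons mulrDr addrC.
have pp : 0 <= p * (1 - p) by rewrite mulr_ge0 // subr_ge0.
have e : \sum_(j <- s) avg p (i :: s) (dif j f) A ^+ 2 <=
   p * \sum_(j <- s) avg p s (dif j f) (i |: A) ^+ 2 +
   (1 - p) * \sum_(j <- s) avg p s (dif j f) (A :\ i) ^+ 2.
  rewrite !mulr_sumr -big_split; apply: ler_sum => j _; rewrite avg_cons /=.
  set a := avg _ _ _ _; set b := avg _ _ _ _.
  rewrite -subr_ge0; have -> : p * a ^+ 2 + (1 - p) * b ^+ 2 -
    (p * a + (1 - p) * b) ^+ 2 = p * (1 - p) * (a - b) ^+ 2 by ring.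
  by rewrite mulr_ge0 // sqr_ge0.
have -> : avg p (i :: s) (dif i f) A = avg p s (dif i f) A.
  by rewrite avg_cons avg_dif_U1 // avg_dif_D1 //; ring.
rewrite lerD2r; apply: le_trans (ler_wpM2l pp e) _.
have p1' : 0 <= 1 - p by rewrite subr_ge0.
have hU := ler_wpM2l p0 (IH (i |: A) us).
have hD := ler_wpM2l p1' (IH (A :\ i) us).
by apply: le_trans _ (lerD hU hD); rewrite le_eqVlt; apply/orP; left; apply/eqP; ring.
Qed.

(* In Fourier terms: the coefficient on a set of size s contributes
   [s + (s == 1)] on the right, which is at least 2 whenever s > 0. *)
Lemma var_le_influence p s f A : 0 <= p <= 1 -> uniq s ->
  2 * var p s f A <= p * (1 - p) *
    (\sum_(j <- s) avg p s (fun B => dif j f B ^+ 2) A +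
     \sum_(j <- s) avg p s (dif j f) A ^+ 2).
Proof.
move=> p01; have /andP[p0 p1] := p01.
elim: s A => [|i s IH] A.
  by rewrite !big_nil addr0 mulr0 /var subrr mulr0.
rewrite cons_uniq => /andP[iNs us]; rewrite var_cons // !big_cons.
have pp : 0 <= p * (1 - p) by rewrite mulr_ge0 // subr_ge0.
set m := avg p s (dif i f) A.
have -> : avg p (i :: s) (dif i f) A = m.
  by rewrite avg_cons avg_dif_U1 // avg_dif_D1 // -/m; ring.
have -> : avg p (i :: s) (fun B => dif i f B ^+ 2) A =
          avg p s (fun B => dif i f B ^+ 2) A.
  have [] := @avg_fixed p s i (fun B => dif i f B ^+ 2) A iNs.
  - by move=> B; rewrite dif_U1.
  - by move=> B; rewrite dif_D1.
  by rewrite avg_cons => -> ->; ring.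
have bes := @level1_le_var p s (dif i f) A p01 us.
rewrite {1}/var -/m in bes.
set M := avg p s _ A in bes *.
have hU := ler_wpM2l p0 (IH (i |: A) us).
have p1' : 0 <= 1 - p by rewrite subr_ge0.
have hD := ler_wpM2l p1' (IH (A :\ i) us).
have e1 : \sum_(j <- s) avg p (i :: s) (fun B => dif j f B ^+ 2) A =
   p * \sum_(j <- s) avg p s (fun B => dif j f B ^+ 2) (i |: A) +
   (1 - p) * \sum_(j <- s) avg p s (fun B => dif j f B ^+ 2) (A :\ i).
  by rewrite !mulr_sumr -big_split.
have e2 : \sum_(j <- s) avg p (i :: s) (dif j f) A ^+ 2 =
   p * \sum_(j <- s) avg p s (dif j f) (i |: A) ^+ 2 +
   (1 - p) * \sum_(j <- s) avg p s (dif j f) (A :\ i) ^+ 2 -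
   p * (1 - p) * \sum_(j <- s) avg p s (dif j (dif i f)) A ^+ 2.
  rewrite !mulr_sumr -big_split /= -sumrB.
  apply: eq_bigr => j _; rewrite /avg1.
  have -> : avg p s (dif j (dif i f)) A =
    avg p s (dif j f) (i |: A) - avg p s (dif j f) (A :\ i).
    rewrite (eq_avg p s A (dif_dif j i f)) dif_avg //.
  by ring.
rewrite e1 e2.
have hb := ler_wpM2l pp bes.
move: hU hD hb.
set a1 := var _ _ _ _; set a2 := var _ _ _ _.
set b1 := \sum_(j <- s) _; set b2 := \sum_(j <- s) _.
set b3 := \sum_(j <- s) _; set b4 := \sum_(j <- s) _.
set b5 := \sum_(j <- s) _.
move=> hU hD hb.
set w := p * (1 - p) in hU hD hb *.
clearbody w; lra.
Qed.

End Cube.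

(** * Convexity of powers *)

Lemma powR_conv (R : realType) (t l x y : R) : 1 <= t -> 0 <= l -> l <= 1 ->
    0 <= x -> 0 <= y ->
  (l * x + (1 - l) * y) `^ t <= l * x `^ t + (1 - l) * y `^ t.
Proof.
move=> t1 l0 l1 x0 y0.
have := @convex_powR R t t1 (Itv01 l0 l1) x y.
by rewrite !convRE /=; apply; apply: mem_set; rewrite /= in_itv /= andbT.
Qed.

Lemma powR_increment (R : realType) (t x y c : R) : 1 <= t -> 0 <= y ->
    y <= x -> 0 <= c ->
  (y + c) `^ t + x `^ t <= (x + c) `^ t + y `^ t.
Proof.
move=> t1 y0 yx c0.
have [xcy|] := eqVneq (x + c) y.
  have -> : x = y by apply/eqP; rewrite eq_le yx andbT; lra.
  by [].

move=> neq; have gt : 0 < x + c - y.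
  by rewrite lt_neqAle subr_ge0 eq_sym subr_eq0 neq /=; lra.
(* With weight [l], y + c is a convex combination of x + c and y; with the weights exchanged, so is
   x. The two convexity inequalities add up to the claim. *)
pose l := c / (x + c - y).
have l0 : 0 <= l by rewrite divr_ge0 // ltW.
have l1 : l <= 1 by rewrite ler_pdivrMr // mul1r; lra.
have x0 : 0 <= x + c by lra.
have h1 := powR_conv t1 l0 l1 x0 y0.
have h2 := @powR_conv R t (1 - l) (x + c) y t1 ltac:(lra) ltac:(lra) x0 y0.
have e : l * (x + c - y) = c by rewrite divfK // gt_eqF.
have e1 : l * (x + c) + (1 - l) * y = y + c.
  have -> : l * (x + c) + (1 - l) * y = y + l * (x + c - y) by ring.
  by rewrite e.
have e2 : (1 - l) * (x + c) + (1 - (1 - l)) * y = x.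
  have -> : (1 - l) * (x + c) + (1 - (1 - l)) * y = x + c - l * (x + c - y) by ring.
  by rewrite e addrK.
rewrite e1 in h1; rewrite e2 in h2; lra.
Qed.

(** * Dependence on the bias, influential coordinates and concentration *)

Section CubeAnalysis.
Variables (R : realType) (T : finType).
Implicit Types (p : R) (s : seq T) (f g : {set T} -> R) (A B : {set T}).

Lemma is_derive_mix (u v : R -> R) (du dv p : R) :
    is_derive p (1 : R) u du -> is_derive p (1 : R) v dv ->
  is_derive p (1 : R) (fun x => x * u x + (1 - x) * v x)
    (u p - v p + (p * du + (1 - p) * dv)).
Proof.
move=> hu hv.
have -> : (fun x => x * u x + (1 - x) * v x) = v + id * (u - v).
  apply/funext => x; transitivity (v x + x * (u x - v x)); last by [].
  by move: (u x) (v x) => a b; ring.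
apply: is_derive_eq (is_deriveD hv (is_deriveM (is_derive_id p 1) (is_deriveB hu hv))) _.
transitivity (dv + (p * (du - dv) + (u p - v p) * 1)); first by [].
by move: (u p) (v p) => a b; ring.
Qed.

(** Russo's formula, for arbitrary f: the average is affine in the bias of each single coordinate,
    so each coordinate contributes one discrete derivative. *)
Lemma is_derive_avg p s f A : uniq s ->
  is_derive p (1 : R) (fun x => avg x s f A) (\sum_(j <- s) avg p s (dif j f) A).
Proof.
elim: s A => [|i s IH] A.
  by rewrite big_nil => _; exact: is_derive_cst.
rewrite cons_uniq => /andP[iNs us].
apply: is_derive_eq (is_derive_mix (IH (i |: A) us) (IH (A :\ i) us)) _.
rewrite big_cons; congr (_ + _).
  by rewrite avg_cons avg_dif_U1 // avg_dif_D1 // dif_avg // -mulrDl subrKC mul1r.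
by rewrite big_split -!mulr_sumr.
Qed.

Lemma avg_le_prob p p' s f A : 0 <= p -> p <= p' -> p' <= 1 -> nondec f ->
  avg p s f A <= avg p' s f A.
Proof.
move=> p0 pp p1 ndf; elim: s A => [//|i s IH] A; rewrite !avg_cons.
have h1 := ler_wpM2l p0 (IH (i |: A)).
have h0 := @ler_wpM2l _ (1 - p) ltac:(lra) _ _ (IH (A :\ i)).
apply: le_trans (lerD h1 h0) _.
have ndg : nondec (avg p' s f) by apply: avg_nondec => //; lra.
have /ndg hab : A :\ i \subset i |: A.
  by apply: subset_trans (subsetUr _ _); apply: subD1set.
by move: (avg p' s f (i |: A)) (avg p' s f (A :\ i)) hab => a b hab; nra.
Qed.

Lemma avg_powR p t s f : 0 <= p <= 1 -> 1 <= t -> nondec f ->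
    (forall B, f B = 0 \/ f B = 1) ->
  forall A, avg (p `^ t) s f A <= (avg p s f A) `^ t.
Proof.
move=> p01 t1 ndf f01; have /andP[p0 p1] := p01.
have f0 B : 0 <= f B by case: (f01 B) => ->.
elim: s => [|i s IH] A /=.
  case: (f01 A) => ->; last by rewrite powR1.
  by rewrite powR_ge0.
rewrite /avg1; set a := avg p s f (i |: A); set b := avg p s f (A :\ i).
have b0 : 0 <= b by apply: avg_ge0.
have ba : b <= a.
  apply: avg_nondec => //; apply: (@subset_trans _ _ A).
  - exact: subD1set.
  - exact: subsetUr.
have a0 := le_trans b0 ba.
have pt0 : 0 <= p `^ t by rewrite powR_ge0.
have pt1 : p `^ t <= 1.
  have [p_0|pn] := eqVneq p 0; last first.
    by apply: (le_trans (ge1r_powR _ t1) p1); rewrite lt0r pn p0 p1.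
  have tn : t != 0 by rewrite gt_eqF // (lt_le_trans ltr01).
  by rewrite p_0 powR0 // ler01.
have h1 := ler_wpM2l pt0 (IH (i |: A)).
have h0 := @ler_wpM2l _ (1 - p `^ t) ltac:(lra) _ _ (IH (A :\ i)).
apply: le_trans (lerD h1 h0) _; rewrite -/a -/b.
clearbody a b; clear h1 h0 IH.
have q0 : 0 <= 1 - p by lra.
(* Comparing the increments of the power over steps of length (1 - p) b from p b and from p a gives
   the two-point inequality p^t a^t + (1 - p^t) b^t <= (p a + (1 - p) b)^t for b <= a. *)
have h2 := @powR_increment R t (p * a) (p * b) ((1 - p) * b) t1
  (mulr_ge0 p0 b0) (ler_wpM2l p0 ba) (mulr_ge0 q0 b0).
have e : p * b + (1 - p) * b = b by ring.
rewrite e (powRM _ p0 a0) (powRM _ p0 b0) in h2.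
move: (p `^ t) (a `^ t) (b `^ t) h2 => x y z h2.
by move: ((p * a + (1 - p) * b) `^ t) h2 => w h2; lra.
Qed.

(** If all averages of f without i exceeded [gam], every influence would be at most 1 - gam, and the
    squared influences would sum to at most 1 - gam times the total. At the mean value point the
    total is at most 1 + 2 e / (q - p1), so the Poincare inequality bounds 2 var by about (2 - gam)
    p (1 - p). But var is close to p (1 - p), as the average lies within q - p1 + e of p. *)
Lemma influential_coordinate s f A (p1 q e v gam : R) :
    uniq s -> nondec f -> (forall B, f B = 0 \/ f B = 1) ->
    0 <= p1 -> p1 < q -> q <= 1 -> 0 <= e -> 0 < v -> v <= p1 * (1 - q) ->
    0 <= gam -> gam <= 1 ->
    2 * (q - p1 + e) + 4 * (e / (q - p1)) * v < gam * v ->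
    p1 - e <= avg p1 s f A -> avg q s f A <= q + e ->
  exists p i, [/\ p1 <= p, p <= q, i \in s &
    avg p s (fun B => f (B :\ i)) A <= gam].
Proof.
move=> us ndf f01 p10 p1q q1 e0 v0 hv gam0 gam1 hyp lo hi.
pose phi x := avg x s f A.
have dphi x : is_derive x (1 : R) phi (\sum_(j <- s) avg x s (dif j f) A).
  exact: is_derive_avg.
have [|p pI eqp] := @MVT_segment R phi _ p1 q (ltW p1q) (fun x _ => dphi x).
  apply: continuous_subspaceT => x.
  apply: differentiable_continuous; apply/derivable1_diffP.
  exact: (@ex_derive _ _ _ _ _ _ _ (dphi x)).
move: pI; rewrite in_itv /= => /andP[p1p pq].
have p01 : 0 <= p <= 1 by apply/andP; split; lra.
apply: contrapT => no.
have {}no i : i \in s -> gam < avg p s (fun B => f (B :\ i)) A.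
  by move=> iS; rewrite ltNge; apply/negP => h; apply: no; exists p, i.
have f_le1 B : f B <= 1 by case: (f01 B) => ->; rewrite ?ler01.
have dif01 i B : dif i f B ^+ 2 = dif i f B.
  have := nondec_dif_ge0 i B ndf; rewrite /dif.
  by case: (f01 (i |: B)) => ->; case: (f01 (B :\ i)) => -> h; try ring; lra.
have Ipos i : 0 <= avg p s (dif i f) A.
  by apply: avg_ge0 => // B; apply: nondec_dif_ge0.
have Ile i : i \in s -> avg p s (dif i f) A <= 1 - gam.
  move=> /no h; rewrite avgB.
  have := @avg_le1 R T p s (fun B => f (i |: B)) A p01 (fun B => f_le1 _).
  lra.
have := @var_le_influence R T p s f A p01 us.
have -> : \sum_(j <- s) avg p s (fun B => dif j f B ^+ 2) A =
    \sum_(j <- s) avg p s (dif j f) A.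
  by apply: eq_bigr => j _; apply: eq_avg => B.
have -> : var p s f A = phi p - phi p ^+ 2.
  rewrite /var /phi; congr (_ - _); apply: eq_avg => B.
  by case: (f01 B) => ->; ring.
have : \sum_(j <- s) avg p s (dif j f) A ^+ 2 <=
   (1 - gam) * \sum_(j <- s) avg p s (dif j f) A.
  rewrite mulr_sumr big_seq [leRHS]big_seq; apply: ler_sum => j js.
  by rewrite expr2 ler_wpM2r // Ile.
have S1ge : 0 <= \sum_(j <- s) avg p s (dif j f) A.
  by apply: sumr_ge0.
move: S1ge eqp.
set S1 := \sum_(j <- s) avg p s (dif j f) A.
set S2 := \sum_(j <- s) _; move=> S1ge eqp S21 infl.
have phi_lo : phi p1 <= phi p by apply: avg_le_prob => //; lra.
have phi_hi : phi p <= phi q by apply: avg_le_prob => //; lra.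
have phi0 : 0 <= phi p1.
  by apply: avg_ge0 => [|B]; [apply/andP; split; lra | case: (f01 B) => ->].
have phi1 : phi q <= 1 by apply: avg_le1 => //; apply/andP; split; lra.
rewrite -/(phi p1) in lo; rewrite -/(phi q) in hi.
set del := q - p1 in hyp eqp.
have del0 : 0 < del by rewrite /del; lra.
set lam := e / del in hyp.
have lam0 : 0 <= lam by rewrite divr_ge0 // ltW.
have elam : e = lam * del by rewrite /lam divfK // gt_eqF.
have S1le : S1 <= 1 + 2 * lam.
  rewrite -(ler_pM2r del0) -eqp.
  have -> : (1 + 2 * lam) * del = del + 2 * e by rewrite elam; ring.
  rewrite /del; lra.
set w := p * (1 - p) in infl.
have wv : v <= w.
  apply: le_trans hv _; rewrite /w; apply: ler_pM => //; lra.
have var_ge : w - (del + e) <= phi p - phi p ^+ 2.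
  have -> : phi p - phi p ^+ 2 = w + (phi p - p) * (1 - phi p - p).
    by rewrite /w; ring.
  have : `|(phi p - p) * (1 - phi p - p)| <= del + e.
    rewrite normrM -[leRHS]mulr1; apply: ler_pM; rewrite ?normr_ge0 //.
      by rewrite ler_norml /del; apply/andP; split; lra.
    by rewrite ler_norml; apply/andP; split; lra.
  by rewrite ler_norml => /andP[]; lra.
have h1 : w * (S1 + S2) <= w * ((2 - gam) * (1 + 2 * lam)).
  apply: ler_wpM2l; first by lra.
  apply: (@le_trans _ _ ((2 - gam) * S1)); first lra.
  by apply: ler_wpM2l; lra.
have h2 : 2 * (w - (del + e)) <= w * ((2 - gam) * (1 + 2 * lam)) by lra.
have gl : 0 <= gam * lam by rewrite mulr_ge0.
have h3 : (gam - 4 * lam) * w <= 2 * (del + e).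
  have := mulr_ge0 (le_trans (ltW v0) wv) gl; nra.
have h4 : 2 * (del + e) < (gam - 4 * lam) * v by lra.
have h5 : 0 < gam - 4 * lam.
  rewrite -(pmulr_lgt0 _ v0); apply: le_lt_trans h4; lra.
have := ler_wpM2l (ltW h5) wv; lra.
Qed.

Lemma dif_card i A : dif i (fun B => #|B|%:R : R) A = 1.
Proof.
rewrite /dif -setU1D1id cardsU1 !inE eqxx /= natrD.
by rewrite mulr1n addrK.
Qed.

Lemma avg_card p s : uniq s -> avg p s (fun B => #|B|%:R) set0 = p * (size s)%:R.
Proof.
elim: s => [|i s IH]; first by rewrite /= cards0 mulr0.
rewrite cons_uniq => /andP[iNs us].
rewrite avg_cons_dif // set0D IH // (eq_avg _ _ _ (dif_card i)) avg_cst /=.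
by rewrite -[in RHS]addn1 natrD; ring.
Qed.

(** Chebyshev's inequality; the variance of the cardinality comes from [var_le_influence], because
    all its discrete derivatives equal 1. *)
Lemma avg_card_tail p s (m t : R) : 0 <= p <= 1 -> uniq s -> 0 < t ->
    m + t <= p * (size s)%:R ->
  1 - (size s)%:R / t ^+ 2 <= avg p s (fun B => (m <= #|B|%:R)%R%:R) set0.
Proof.
move=> p01 us t0 hm; have /andP[p0 p1] := p01.
have vle : var p s (fun B => #|B|%:R) set0 <= (size s)%:R.
  have := @var_le_influence R T p s (fun B => #|B|%:R) set0 p01 us.
  have -> : \sum_(j <- s) avg p s (fun B => dif j (fun C => #|C|%:R) B ^+ 2) set0
     = (size s)%:R.
    rewrite (eq_bigr (fun=> 1)); last first.
      move=> j _; rewrite -[RHS](avg_cst p s 1 set0).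
      by apply: eq_avg => B; rewrite dif_card expr1n.
    by rewrite big_const_seq count_predT iter_addr_0.
  have -> : \sum_(j <- s) avg p s (dif j (fun C => #|C|%:R)) set0 ^+ 2
     = (size s)%:R.
    rewrite (eq_bigr (fun=> 1)); last first.
      move=> j _; rewrite (eq_avg _ _ _ (dif_card j)) avg_cst expr1n //.
    by rewrite big_const_seq count_predT iter_addr_0.
  have sz : 0 <= (size s)%:R :> R by [].
  move: (size s)%:R sz => z sz; move: (var _ _ _ _) => w h; nra.
pose mu : R := p * (size s)%:R.
have e : var p s (fun B => #|B|%:R) set0 =
    avg p s (fun B => (#|B|%:R - mu) ^+ 2) set0.
  rewrite (@eq_avg _ _ _ _ (fun B => (#|B|%:R - mu) ^+ 2)
     (fun B => #|B|%:R ^+ 2 + ((- 2 * mu) * #|B|%:R + mu ^+ 2))); last first.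
    by move=> B; ring.
  rewrite avgD avgD avgZ avg_cst avg_card // /var avg_card // -/mu; ring.
have : avg p s (fun B => t ^+ 2 * (1 - (m <= #|B|%:R)%R%:R)) set0 <=
   avg p s (fun B => (#|B|%:R - mu) ^+ 2) set0.
  apply: le_avg => // B _; case: (leP m #|B|%:R) => h /=.
    by rewrite subrr mulr0 sqr_ge0.
  rewrite subr0 mulr1 -[leRHS]sqrrN opprB; apply: lerXn2r; rewrite ?nnegrE /mu; lra.
rewrite -e avgZ avgB avg_cst => h.
have {h} := le_trans h vle; rewrite mulrC -ler_pdivlMr ?exprn_gt0 //; lra.
Qed.

(** * Invariance of the average under permutations *)

Lemma avg1_comm p i j f A : avg1 p i (avg1 p j f) A = avg1 p j (avg1 p i f) A.
Proof.
have [->//|ij] := eqVneq i j.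
rewrite /avg1 (setU1CA i j) -!setU1D1 ?(setD1CA i j) // 1?eq_sym //.
by ring.
Qed.

Lemma eq_avg1 p i f g A : f =1 g -> avg1 p i f A = avg1 p i g A.
Proof. by move=> fg; rewrite /avg1 !fg. Qed.

Lemma avg_perm p s s' f A : perm_eq s s' -> avg p s f A = avg p s' f A.
Proof.
elim: s s' A => [|i s IH] s' A.
  by rewrite perm_sym => /perm_nilP ->.
move=> pe; have : i \in s' by rewrite -(perm_mem pe) mem_head.
move=> /splitPr e; case: e pe => s1 s2 pe.
have {}pe : perm_eq s (s1 ++ s2).
  by rewrite -(perm_cons i) (perm_trans pe) // perm_catC /= perm_cons perm_catC.
rewrite /= (eq_avg1 _ _ _ (fun B => IH _ B pe)) {IH pe}.
elim: s1 A => [//|j s1 IH] A /=.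
rewrite avg1_comm; apply: eq_avg1 => B; exact: IH.
Qed.

Lemma avg_imset (sigma : {perm T}) p s f A :
  avg p s (fun B => f (sigma @: B)) A = avg p (map sigma s) f (sigma @: A).
Proof.
elim: s A => [//|i s IH] A; rewrite /= /avg1 !IH imsetU1; congr (_ + _ * _).
congr (avg _ _ _ _); apply/setP => x; rewrite !inE.
by rewrite -(permKV sigma x) !mem_imset ?inE ?(inj_eq perm_inj) //; exact: perm_inj.
Qed.

Lemma avg_perm_on (S : {set T}) (sigma : {perm T}) p f A :
    perm_on S sigma ->
  avg p (enum S) (fun B => f (sigma @: B)) A = avg p (enum S) f (sigma @: A).
Proof.
move=> son; rewrite avg_imset; apply: avg_perm.
apply: uniq_perm; rewrite ?enum_uniq // ?map_inj_uniq ?enum_uniq //.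
  exact: perm_inj.
move=> x; rewrite mem_enum -{1}(permKV sigma x) mem_map; last exact: perm_inj.
by rewrite mem_enum; have := perm_closed (sigma^-1%g x) son; rewrite permKV.
Qed.

End CubeAnalysis.

(** * Uniform families with a prescribed trace *)

Section Cylinder.
Variable T : finType.
Implicit Types (k : nat) (Z Q A B X : {set T}) (G : {set {set T}}).

Definition cyl k Z Q := [set A : {set T} | (#|A| == k) && (A :&: Z == Q)].

Lemma in_cyl k Z Q A : (A \in cyl k Z Q) = (#|A| == k) && (A :&: Z == Q).
Proof. by rewrite inE. Qed.

Lemma card_cyl k Z Q : Q \subset Z -> (#|Q| <= k)%N ->
  #|cyl k Z Q| = 'C(#|T| - #|Z|, k - #|Q|).
Proof.
move=> QZ Qk; rewrite -[X in (_ - #|pred_of_set X|)%N]setCK -cardsCs -cards_draws.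
have inj : {in cyl k Z Q &, injective (fun A => A :\: Z)}.
  move=> A B; rewrite !in_cyl => /andP[_ /eqP eA] /andP[_ /eqP eB] /= e.
  by rewrite -(setID A Z) -(setID B Z) eA eB e.
rewrite -(card_in_imset inj); apply: eq_card => B; rewrite inE.
apply/imsetP/andP => [[A]|[BZ /eqP cB]].
  rewrite in_cyl => /andP[/eqP cA /eqP AZ] ->; split.
    by rewrite setDE subsetIr.
  by rewrite cardsD cA AZ.
have BZ0 : B :&: Z = set0.
  by apply/eqP; rewrite setI_eq0 disjoints_subset.
exists (B :|: Q); last first.
  rewrite setDUl; have /eqP -> : Q :\: Z == set0 by rewrite setD_eq0.
  by rewrite setU0; apply/esym/setDidPl; rewrite disjoints_subset.
rewrite in_cyl setIUl BZ0 set0U (setIidPl QZ) eqxx andbT cardsU cB.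
have -> : B :&: Q = set0.
  by apply/eqP; rewrite -subset0 -BZ0 setIS.
by rewrite cards0 subn0 subnK.
Qed.

Lemma cyl_in k Z Q x : x \notin Z -> Q \subset Z ->
  cyl k (x |: Z) (x |: Q) = [set A in cyl k Z Q | x \in A].
Proof.
move=> xZ QZ; apply/setP => A; rewrite !inE -andbA; congr (_ && _).
have xQ : x \notin Q by apply: contra xZ; apply: (subsetP QZ).
apply/eqP/andP => [e|[/eqP <- xA]].
  have xA : x \in A by have := setU11 x Q; rewrite -e inE => /andP[].
  split=> //; apply/eqP/setP => y; move/setP/(_ y): e; rewrite !inE.
  by case: (eqVneq y x) => [->|] //=; rewrite (negbTE xZ) (negbTE xQ) andbF.
apply/setP => y; rewrite !inE; case: (eqVneq y x) => [->|] //=.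
by rewrite xA.
Qed.

Lemma cyl_notin k Z Q x : x \notin Z -> Q \subset Z ->
  cyl k (x |: Z) Q = [set A in cyl k Z Q | x \notin A].
Proof.
move=> xZ QZ; apply/setP => A; rewrite !inE -andbA; congr (_ && _).
have xQ : x \notin Q by apply: contra xZ; apply: (subsetP QZ).
apply/eqP/andP => [e|[/eqP <- xA]].
  have xA : x \notin A.
    by apply: contra xQ => xA; rewrite -e !inE eqxx xA.
  split=> //; apply/eqP/setP => y; move/setP/(_ y): e; rewrite !inE.
  by case: (eqVneq y x) => [->|] //=; rewrite (negbTE xZ) (negbTE xQ) andbF.
apply/setP => y; rewrite !inE; case: (eqVneq y x) => [->|] //=.
by rewrite (negbTE xA).
Qed.

Lemma card_split_elem G x :
  (#|[set A in G | x \in A]| + #|[set A in G | x \notin A]| = #|G|)%N.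
Proof.
rewrite -(cardsID [set A : {set T} | x \in A] G); congr (_ + _)%N.
  by apply: eq_card => A; rewrite !inE.
by apply: eq_card => A; rewrite !inE andbC.
Qed.

Lemma card_cyl_split k Z Q x : x \notin Z -> Q \subset Z ->
  (#|cyl k (x |: Z) (x |: Q)| + #|cyl k (x |: Z) Q| = #|cyl k Z Q|)%N.
Proof. by move=> xZ QZ; rewrite cyl_in // cyl_notin // card_split_elem. Qed.

Lemma card_cyl_in k Z Q x : x \notin Z -> Q \subset Z -> (#|Q| < k)%N ->
  ((#|T| - #|Z|) * #|cyl k (x |: Z) (x |: Q)| = (k - #|Q|) * #|cyl k Z Q|)%N.
Proof.
move=> xZ QZ Qk.
have xQ : x \notin Q by apply: contra xZ; apply: (subsetP QZ).
rewrite !card_cyl ?setUS ?cardsU1 ?xQ ?xZ ?add1n ?(ltnW Qk) //.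
by rewrite !subnS mul_bin_diag prednK ?subn_gt0.
Qed.

Lemma imset_tperm x y B : x \in B -> y \notin B ->
  tperm x y @: B = y |: (B :\ x).
Proof.
move=> xB yB; have nxy : x != y by apply: contraNneq yB => <-.
apply/setP => z; rewrite -{1}(tpermK x y z) mem_imset; last exact: perm_inj.
rewrite !inE; case: tpermP => [->|->|/eqP zx /eqP zy].
- by rewrite (negbTE yB) (negbTE nxy) eqxx.
- by rewrite xB eqxx.
- by rewrite (negbTE zx) (negbTE zy).
Qed.

Lemma perm_cyl k Z Q X (sigma : {perm T}) : perm_on (~: Z) sigma ->
  X \in cyl k Z Q -> sigma @: X \in cyl k Z Q.
Proof.
move=> son; rewrite !in_cyl card_imset; last exact: perm_inj.
move=> /andP[-> /eqP <-] /=; apply/eqP/setP => z; rewrite !inE.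
case: (boolP (z \in Z)) => zZ; rewrite ?andbF ?andbT //.
have <- : sigma z = z by apply: out_perm son _; rewrite inE zZ.
rewrite mem_imset //; last exact: perm_inj.
by rewrite (out_perm son) // inE zZ.
Qed.

(** Composing with the transposition of a point of B minus B' and a point of B' minus B is a
    bijection on the permutations fixing Z pointwise, and it moves the target B one step closer to
    B'. *)
Lemma card_perm_imset_eq k Z Q X B B' :
    B \in cyl k Z Q -> B' \in cyl k Z Q ->
  #|[set sigma : {perm T} | perm_on (~: Z) sigma & sigma @: X == B]| =
  #|[set sigma : {perm T} | perm_on (~: Z) sigma & sigma @: X == B']|.
Proof.
move: {2}#|B :\: B'| (leqnn #|B :\: B'|) => m.
elim: m B => [|m IH] B.
  rewrite leqn0 cards_eq0 setD_eq0 => sBB' hB hB'.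
  suff -> : B = B' by [].
  apply/eqP; rewrite eqEcard sBB' /=.
  by move: hB hB'; rewrite !in_cyl => /andP[/eqP -> _] /andP[/eqP -> _].
move=> hm hB hB'.
have [-> //|neq] := eqVneq B B'.
have [cB cB'] : #|B| = k /\ #|B'| = k.
  by move: hB hB'; rewrite !in_cyl => /andP[/eqP -> _] /andP[/eqP -> _].
have [x xB xB'] : exists2 x, x \in B & x \notin B'.
  by apply/subsetPn; apply: contra neq => s; rewrite eqEcard s cB cB' leqnn.
have [y yB' yB] : exists2 y, y \in B' & y \notin B.
  by apply/subsetPn; apply: contra neq => s; rewrite eq_sym eqEcard s cB cB' leqnn.
have tr z : (z \in Z) -> (z \in B) = (z \in B').
  move=> zZ; move: hB hB'; rewrite !in_cyl => /andP[_ /eqP e] /andP[_ /eqP].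
  by rewrite -e => /setP/(_ z); rewrite !inE zZ !andbT.
have xZ : x \notin Z by apply: contraL xB => /tr ->.
have yZ : y \notin Z by apply: contraL yB' => /tr <-.
have ton : perm_on (~: Z) (tperm x y).
  apply/subsetP => z; rewrite inE; apply: contraNT; rewrite inE negbK => zZ.
  by apply/eqP/tpermD; [apply: contraNneq xZ => -> | apply: contraNneq yZ => ->].
rewrite -(IH (tperm x y @: B)) //; last 2 first.
- rewrite imset_tperm //.
  apply: leq_trans (_ : #|(B :\: B') :\ x| <= _)%N; last first.
    by move: hm; rewrite (cardsD1 x) !inE xB xB'.
  apply: subset_leq_card; apply/subsetP => z; rewrite !inE.
  by case: (eqVneq z y) => [->|] /=; rewrite ?yB' // => _ /and3P[-> -> ->].
- exact: perm_cyl.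
rewrite -(card_imset _ (mulIg (tperm x y))); apply: eq_card => sigma.
rewrite !inE; apply/imsetP/andP => [[tau]|[son /eqP e]].
  rewrite inE => /andP[ton' /eqP e] ->; split; first exact: perm_onM.
  apply/eqP; rewrite -e -imset_comp; apply: eq_imset => z /=.
  by rewrite permM.
exists (sigma * tperm x y)%g; last by rewrite -mulgA tperm2 mulg1.
rewrite inE perm_onM //=; apply/eqP; apply: (imset_inj (@perm_inj _ (tperm x y))).
rewrite -e -imset_comp; apply: eq_imset => z /=.
by rewrite permM tpermK.
Qed.

(** In counting form: the image of X under a uniform permutation fixing Z pointwise is uniform on
    the cylinder of X. *)
Lemma card_perm_imset_in k Z Q X G : X \in cyl k Z Q -> G \subset cyl k Z Q ->
  (#|[set sigma : {perm T} | perm_on (~: Z) sigma & sigma @: X \in G]|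
     * #|cyl k Z Q| = #|G| * #|[set sigma : {perm T} | perm_on (~: Z) sigma]|)%N.
Proof.
move=> hX sG.
pose nu B := #|[set sigma : {perm T} | perm_on (~: Z) sigma & sigma @: X == B]|.
have cnt (H : {set {set T}}) : H \subset cyl k Z Q ->
  #|[set sigma : {perm T} | perm_on (~: Z) sigma & sigma @: X \in H]| =
  (#|H| * nu X)%N.
  move=> sH; rewrite -sum1_card.
  rewrite (partition_big (fun sigma : {perm T} => sigma @: X) (fun B => B \in H)) /=; last first.
    by move=> sigma; rewrite inE => /andP[].
  rewrite (eq_bigr (fun=> nu X)) ?sum_nat_const // => B BH.
  rewrite /nu (card_perm_imset_eq X hX (subsetP sH _ BH)) -[in RHS]sum1_card.
  apply: eq_bigl => sigma; rewrite !inE.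
  by case: (eqVneq (sigma @: X) B) => [->|]; rewrite ?BH ?andbT ?andbF.
have -> : [set sigma : {perm T} | perm_on (~: Z) sigma] =
  [set sigma : {perm T} | perm_on (~: Z) sigma & sigma @: X \in cyl k Z Q].
  apply/setP => sigma; rewrite [LHS]inE [RHS]inE.
  by case: (boolP (perm_on _ _)) => // h; rewrite (perm_cyl h).
by rewrite !cnt // -mulnA [(nu X * _)%N]mulnC.
Qed.

End Cylinder.

(** * From uniform families to the cube *)

Section UpClosure.
Variables (R : realType) (T : finType).
Implicit Types (p : R) (s : seq T) (f : {set T} -> R) (A B Z Q W : {set T}).
Implicit Types (G F : {set {set T}}) (k : nat).

(** Write p0 = p^t with t >= 1. An average below (1 - e) p at p would give one below (1 - e)^t p0 <=
    (1 - e) p0 at p0, so the relative deficit does not grow with the bias. *)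
Lemma avg_lower p0 p e s f A : 0 < p0 -> p0 <= p -> p < 1 -> 0 <= e -> e <= 1 ->
    nondec f -> (forall B, f B = 0 \/ f B = 1) ->
  (1 - e) * p0 <= avg p0 s f A -> (1 - e) * p <= avg p s f A.
Proof.
move=> p00 p0p p1 e0 e1 ndf f01 h.
have pp0 : 0 < p by lra.
have lnp : ln p < 0 by rewrite ln_lt0 // pp0.
have p0t : p `^ (ln p0 / ln p) = p0.
  by rewrite /powR gt_eqF // divfK ?lt_eqF // lnK.
have t1 : 1 <= ln p0 / ln p.
  by rewrite ler_ndivlMr // mul1r ler_ln.
have p01 : 0 <= p <= 1 by rewrite !ltW.
have := avg_powR s p01 t1 ndf f01 A; rewrite p0t.
set t := ln p0 / ln p in p0t t1 *; set a := avg p s f A.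
move=> hpow; rewrite leNgt; apply/negP => alt.
have a0 : 0 <= a by apply: avg_ge0 => // B; case: (f01 B) => ->.
have t0 : 0 < t by lra.
have b0 : 0 <= 1 - e by lra.
have := gt0_ltr_powR t0 _ _ alt; rewrite !nnegrE => /(_ a0).
move=> /(_ (mulr_ge0 b0 (ltW pp0))); rewrite powRM ?(ltW pp0) // p0t.
have : (1 - e) `^ t <= 1 - e.
  have [->|en] := eqVneq (1 - e) 0; first by rewrite powR0 // gt_eqF.
  by apply: ge1r_powR => //; rewrite lt0r en b0; lra.
move=> h1 h2; have := ler_wpM2r (ltW p00) h1; lra.
Qed.

Lemma avg_base p s f A A' : (forall x, x \notin s -> (x \in A) = (x \in A')) ->
  avg p s f A = avg p s f A'.
Proof.
elim: s A A' => [|i s IH] A A' h.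
  by congr (f _); apply/setP => x; rewrite h.
rewrite !avg_cons; congr (_ * _ + _ * _); apply: IH => x xs; rewrite !inE;
  have := h x; rewrite inE negb_or xs andbT; by case: (eqVneq x i) => //= _ ->.
Qed.

Definition up Z G A : R := [exists B in G, B :\: Z \subset A]%:R.

Lemma up01 Z G A : up Z G A = 0 \/ up Z G A = 1.
Proof. by rewrite /up; case: existsP => _; [right | left]. Qed.

Lemma up_nondec Z G : nondec (up Z G).
Proof.
move=> A B AB; rewrite /up ler_nat; case: existsP => // -[C /andP[CG sC]].
have -> // : [exists C in G, C :\: Z \subset B].
by apply/existsP; exists C; rewrite CG (subset_trans sC).
Qed.

(** This turns the conclusion of [influential_coordinate], which concerns f with i removed, into a
    bound for the members that miss i. *)
Lemma up_avoid Z G i A :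
  up Z [set B in G | i \notin B] A <= up Z G (A :\ i).
Proof.
rewrite /up ler_nat; case: existsP => // -[C]; rewrite inE -andbA.
move=> /and3P[CG iC sC]; have -> // : [exists B in G, B :\: Z \subset A :\ i].
apply/existsP; exists C; rewrite CG /= subsetD1 sC /=.
by rewrite inE (negbTE iC) andbF.
Qed.

Lemma exists_subset_card A m : (m <= #|A|)%N ->
  exists2 B : {set T}, B \subset A & #|B| = m.
Proof.
move=> hm; have : (0 < #|[set B : {set T} | B \subset A & #|B| == m]|)%N.
  by rewrite cards_draws bin_gt0.
by move=> /card_gt0P[B]; rewrite inE => /andP[BA /eqP cB]; exists B.
Qed.

(* Averaging over the permutations fixing [Z] turns [up Z G] into a function
   that is at least the density of [G] on every large enough set. *)
Lemma up_density p k Z Q G : 0 <= p <= 1 -> Q \subset Z -> (#|Q| <= k)%N ->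
    G \subset cyl k Z Q ->
  #|G|%:R * avg p (enum (~: Z)) (fun A => (k - #|Q| <= #|A|)%N%:R) set0
    <= #|cyl k Z Q|%:R * avg p (enum (~: Z)) (up Z G) set0.
Proof.
move=> p01 QZ Qk sG; set s := enum _.
pose P := [set sigma : {perm T} | perm_on (~: Z) sigma].
have P0 : 0 < #|P|%:R :> R.
  by rewrite ltr0n; apply/card_gt0P; exists 1%g; rewrite inE perm_on1.
rewrite -(ler_pM2l P0).
have -> : #|P|%:R * (#|cyl k Z Q|%:R * avg p s (up Z G) set0) =
   avg p s (fun A => #|cyl k Z Q|%:R * \sum_(sigma in P) up Z G (sigma @: A)) set0.
  rewrite avgZ avg_sum mulrCA; congr (_ * _).
  rewrite -sum1_card natr_sum mulr_suml; apply: eq_bigr => sigma.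
  by rewrite inE => son; rewrite avg_perm_on // imset0 mul1r.
rewrite mulrCA mulrA -avgZ; apply: le_avg => // A.
rewrite set0U => sA.
have {}sA : A \subset ~: Z.
  by apply: subset_trans sA _; apply/subsetP => x; rewrite inE mem_enum.
case: leqP => hA; last first.
  by rewrite mulr0 mulr_ge0 // sumr_ge0 // => sigma _; rewrite ler0n.
rewrite mulr1.
have [A0 A0A cA0] := exists_subset_card hA.
have A0Z : A0 :&: Z = set0.
  by apply/eqP; rewrite setI_eq0 disjoints_subset (subset_trans A0A).
have hX : A0 :|: Q \in cyl k Z Q.
  rewrite in_cyl setIUl A0Z set0U (setIidPl QZ) eqxx andbT cardsU cA0.
  have -> : A0 :&: Q = set0 by apply/eqP; rewrite -subset0 -A0Z setIS.
  by rewrite cards0 subn0 subnK.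
rewrite -natrM -(card_perm_imset_in hX sG) natrM mulrC ler_wpM2l //.
rewrite -sum1_card natr_sum big_mkcond [leRHS]big_mkcond /=.
apply: ler_sum => sigma _; rewrite !inE; case: ifP => [/andP[son hG]|_].
  rewrite son /up; have -> // : [exists B in G, B :\: Z \subset sigma @: A].
  apply/existsP; exists (sigma @: (A0 :|: Q)); rewrite hG /=.
  apply/subsetP => y; rewrite inE => /andP[yZ /imsetP[x xAQ e]].
  rewrite e; apply: imset_f; move: xAQ; rewrite inE => /orP[/(subsetP A0A)//|xQ].
  have xZ := subsetP QZ _ xQ.
  by move: yZ; rewrite e (out_perm son) ?xZ // inE xZ.
by case: ifP => // _; rewrite ler0n.
Qed.

End UpClosure.

(** * Simplices and random colourings *)

(** The point [e j] survives the omission of [X j]. Distinctness of the members comes for free: if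
    [X j] were also some other [X j'], then [e j] would lie in all of them. *)
Lemma contains_simplexI (T J : finType) (d : nat) (F : {set {set T}})
    (I : {set J}) (X : J -> {set T}) (e : J -> T) :
    #|I| = d.+1 -> {in I, forall j, X j \in F} ->
    {in I &, forall j j', j != j' -> e j \in X j'} ->
    (forall x, exists2 j, j \in I & x \notin X j) ->
  contains_simplex d F.
Proof.
move=> cI XF eX capX.
have injX : {in I &, injective X}.
  move=> j j' jI j'I eq; apply/eqP; apply/negPn/negP => neq.
  have [l lI eNl] := capX (e j).
  have [lj|lj] := eqVneq l j; last by rewrite eX // eq_sym in eNl.
  by rewrite lj eq eX in eNl.
exists (X @: I).
  by apply/subsetP => A /imsetP[j jI ->]; apply: XF.
split; first by rewrite card_in_imset.
  apply/setP => x; rewrite inE; apply/negbTE/bigcapP.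
  by have [j jI xj] := capX x; move=> /(_ (X j) (imset_f _ jI)); apply/negP.
move=> S' sS' cS'.
have [j jI jS'] : exists2 j, j \in I & X j \notin S'.
  have : ~~ (X @: I \subset S').
    apply/negP => /subset_leq_card; rewrite card_in_imset // cI cS'.
    by rewrite ltnn.
  by move=> /subsetPn[A /imsetP[j jI ->] h]; exists j.
apply/set0Pn; exists (e j); apply/bigcapP => A AS'.
have /imsetP[j' j'I eA] := subsetP sS' _ AS'.
by rewrite eA eX //; apply: contraNneq jS' => ->; rewrite -eA.
Qed.

Section Colouring.
Variables (R : realType) (T : finType) (W : {set T}) (d : nat).
Hypothesis cardW : #|W| = d.+1.
Implicit Types (c : T -> T) (g : (T -> T) -> R) (s : seq T).

(** The points of W themselves serve as the d + 1 colours, so that colour w is matched with the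
    family of trace W minus w. *)
Definition recolour c i a : T -> T := fun x => if x == i then a else c x.

Fixpoint cavg s g c : R :=
  if s is i :: s' then
    (\sum_(a in W) cavg s' g (recolour c i a)) / d.+1%:R
  else g c.

Definition colour_compl (w : T) c := [set x in ~: W | c x != w].

Lemma cavg_sum s (g : T -> (T -> T) -> R) c :
  cavg s (fun c' => \sum_(w in W) g w c') c = \sum_(w in W) cavg s (g w) c.
Proof.
elim: s c => [//|i s IH] c /=.
rewrite (eq_bigr _ (fun a _ => IH (recolour c i a))) exchange_big /=.
by rewrite mulr_suml.
Qed.

Lemma cavg_le s g M c : (forall x, c x \in W) ->
    (forall c', (forall x, c' x \in W) -> g c' <= M) ->
  cavg s g c <= M.
Proof.
move=> cW gM; elim: s c cW => [|i s IH] c cW /=; first exact: gM.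
rewrite ler_pdivrMr ?ltr0n //.
have -> : M * d.+1%:R = \sum_(a in W) M.
  by rewrite sumr_const cardW mulr_natr.
apply: ler_sum => a aW; apply: IH => x; rewrite /recolour.
by case: ifP.
Qed.

(* The complement of a colour class is a [d / (d + 1)]-biased random set. *)
Lemma cavg_avg s (f : {set T} -> R) w c : w \in W -> {subset s <= ~: W} ->
  cavg s (fun c' => f (colour_compl w c')) c =
  avg (d%:R / d.+1%:R) s f (colour_compl w c).
Proof.
move=> wW; elim: s c => [//|i s IH] c sW.
have iW : i \in ~: W by apply: sW; rewrite mem_head.
have {}sW : {subset s <= ~: W} by move=> x xs; apply: sW; rewrite inE xs orbT.
rewrite avg_cons /= (bigD1 w) //=.
rewrite (eq_bigr (fun=> avg (d%:R / d.+1%:R) s f (i |: colour_compl w c))); last first.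
  move=> a /andP[aW aw]; rewrite IH //; congr (avg _ _ _ _); apply/setP => x.
  rewrite !inE /recolour; case: (eqVneq x i) => [->|_] //=.
  by move: iW; rewrite inE => ->; rewrite aw.
rewrite IH //.
have -> : colour_compl w (recolour c i w) = colour_compl w c :\ i.
  apply/setP => x; rewrite !inE /recolour.
  by case: (eqVneq x i) => [->|_] //=; rewrite eqxx andbF.
have -> : \sum_(a in W | a != w) avg (d%:R / d.+1%:R) s f (i |: colour_compl w c)
   = d%:R * avg (d%:R / d.+1%:R) s f (i |: colour_compl w c).
  rewrite (eq_bigl (fun a => a \in W :\ w)) => [|a]; last by rewrite !inE andbC.
  rewrite sumr_const; move: cardW; rewrite (cardsD1 w) wW add1n => -[->].
  exact/esym/mulr_natl.
have d0 : d%:R + 1 != 0 :> R by rewrite natr1 pnatr_eq0.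
rewrite -natr1; move: (avg _ _ _ (_ |: _)) (avg _ _ _ (_ :\ _)) => x y.
by field.
Qed.

(** For each single colouring at most d of the d + 1 indicators are 1. Otherwise there are members,
    the w-th one avoiding colour w outside W; a point outside W is missed by the member of its
    colour and a point w of W by the w-th member, so they form a simplex. *)
Lemma sum_avg_up_le k (F : {set {set T}}) : ~ contains_simplex d F ->
  \sum_(w in W) avg (d%:R / d.+1%:R : R) (enum (~: W))
     (up R W (F :&: cyl k W (W :\ w))) set0 <= d%:R.
Proof.
move=> noF.
have [w0 w0W] : exists w, w \in W by apply/card_gt0P; rewrite cardW.
pose c0 (x : T) := w0.
have -> : \sum_(w in W) avg (d%:R / d.+1%:R : R) (enum (~: W))
     (up R W (F :&: cyl k W (W :\ w))) set0 =
  cavg (enum (~: W)) (fun c => \sum_(w in W)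
     up R W (F :&: cyl k W (W :\ w)) (colour_compl w c)) c0.
  rewrite cavg_sum; apply: eq_bigr => w wW.
  rewrite (cavg_avg _ (w := w)) // => [|x]; last by rewrite mem_enum.
  by apply: avg_base => x; rewrite mem_enum !inE => /negbTE ->.
apply: cavg_le => // c cW.
case: (boolP [forall w in W, [exists B in F :&: cyl k W (W :\ w),
    B :\: W \subset colour_compl w c]]) => [/forall_inP h|].
  exfalso; apply: noF.
  pose X w := odflt set0 [pick B in F :&: cyl k W (W :\ w) |
                          B :\: W \subset colour_compl w c].
  have hX w : w \in W -> [/\ X w \in F, X w :&: W = W :\ w &
      X w :\: W \subset colour_compl w c].
    move=> wW; rewrite /X; case: pickP => [B /andP[]|none] /=.
      by rewrite inE in_cyl => /andP[BF /andP[_ /eqP ->]].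
    have /exists_inP[B hB hB'] := h w wW.
    by have := none B; rewrite hB hB'.
  apply: (@contains_simplexI T T d F W X id) => //.
  - by move=> w /hX[].
  - move=> w w' wW w'W neq; have [_ e _] := hX _ w'W.
    have : w \in W :\ w' by rewrite !inE neq.
    by rewrite -e inE => /andP[].
  move=> x; case: (boolP (x \in W)) => xW.
    exists x => //; have [_ e _] := hX _ xW.
    by apply/negP => xX; have := setD11 x W; rewrite -e inE xX xW.
  exists (c x) => //; have [_ _ /subsetP/(_ x) s] := hX _ (cW x).
  by apply/negP => xX; have := s; rewrite !inE xX xW eqxx => /(_ isT).
rewrite negb_forall => /existsP[w]; rewrite negb_imply => /andP[wW none].
rewrite (bigD1 w) //= {1}/up (negbTE none) add0r.
apply: le_trans (_ : \sum_(w' in W | w' != w) 1 <= _); last first.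
  rewrite (eq_bigl (fun a => a \in W :\ w)) => [|a]; last by rewrite !inE andbC.
  by rewrite sumr_const; move: cardW; rewrite (cardsD1 w) wW add1n => -[->].
apply: ler_sum => w' _; case: (up01 R W (F :&: cyl k W (W :\ w'))
  (colour_compl w' c)) => ->; by rewrite ?ler01.
Qed.

End Colouring.

(* [p0] slightly exceeds [k / n], so that by Chebyshev a [p]-biased set with
   [p >= p0] has at least [k - d] elements outside an event of probability
   [theta]; the influence obtained at [i] is at least [1 - gam]. *)
Lemma exists_centre (R : realType) (T : finType) (d k : nat) (W : {set T})
    (F : {set {set T}}) (mu t theta p0 p1 eps v gam : R)
    (N := (#|T| - d.+1)%:R : R) (q := d%:R / d.+1%:R : R) :
    (0 < d)%N -> #|W| = d.+1 -> ~ contains_simplex d F -> (d <= k)%N ->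
    (forall w, w \in W -> mu * #|cyl k W (W :\ w)|%:R <=
       #|F :&: cyl k W (W :\ w)|%:R) ->
    0 < t -> (k - d)%:R + t <= p0 * N -> N / t ^+ 2 <= theta -> theta <= 1 / 2 ->
    0 < p0 -> p0 <= p1 -> p1 < q -> 0 <= eps -> eps <= 1 ->
    (1 - eps) * p0 <= mu * (1 - theta) ->
    0 < v -> v <= p1 * (1 - q) -> 0 <= gam -> gam <= 1 ->
    2 * (q - p1 + d%:R * eps) + 4 * (d%:R * eps / (q - p1)) * v < gam * v ->
  forall w, w \in W -> exists2 i, i \notin W &
    #|[set B in F :&: cyl k W (W :\ w) | i \notin B]|%:R <=
      2 * gam * #|cyl k W (W :\ w)|%:R.
Proof.
move=> d0 cW noF dk dens t0 hm hN th2 p00 p0p1 p1q e0 e1 hp0 v0 hv g0 g1 hg.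
set s := enum (~: W).
have us : uniq s by apply: enum_uniq.
have sz : (size s)%:R = N.
  by rewrite /s -cardE [in LHS]cardsCs setCK cW.
have dR : 1 <= d%:R :> R by rewrite ler1n.
have q1 : q < 1 by rewrite /q ltr_pdivrMr ?ltr0n // mul1r ltr_nat.
have th0 : 0 <= theta by apply: le_trans hN; rewrite divr_ge0 // ?sqr_ge0 // /N.
have cWw w : w \in W -> #|W :\ w| = d.
  by move=> wW; move: cW; rewrite (cardsD1 w) wW add1n => -[].
have tail p : p0 <= p -> p <= 1 ->
    1 - theta <= avg p s (fun A => (k - d <= #|A|)%N%:R) set0.
  move=> hp p1'; have p01 : 0 <= p <= 1 by apply/andP; split; lra.
  have := @avg_card_tail R T p s (k - d)%:R t p01 us t0; rewrite sz.
  have : p0 * N <= p * N by apply: ler_wpM2r => //; rewrite /N.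
  move=> h h'; have {h'} := h' ltac:(lra).
  rewrite (@eq_avg R T p s _ (fun A : {set T} => (k - d <= #|A|)%N%:R)); first lra.
  by move=> A; rewrite ler_nat.
have cyl0 w : w \in W -> 0 < #|cyl k W (W :\ w)|%:R :> R.
  move=> wW; rewrite ltr0n card_cyl ?cWw ?subD1set // cW bin_gt0.
  rewrite -(ler_nat R); apply: le_trans (_ : p0 * N <= _); first lra.
  rewrite -/N -[leRHS]mul1r; apply: ler_wpM2r; first by rewrite /N.
  lra.
pose f w := up R W (F :&: cyl k W (W :\ w)).
have ndf w : nondec (f w) by apply: up_nondec.
have f01 w B : f w B = 0 \/ f w B = 1 by apply: up01.
have dp0 w : w \in W -> (1 - eps) * p0 <= avg p0 s (f w) set0.
  move=> wW; have p01 : 0 <= p0 <= 1 by apply/andP; split; lra.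
  have := @up_density R T p0 k W (W :\ w) (F :&: cyl k W (W :\ w)) p01
    (subD1set _ _); rewrite cWw // => /(_ dk (subsetIr _ _)).
  rewrite -/(f w) -/s; have := tail p0 (lexx _) ltac:(lra).
  set a := avg _ _ _ _; set b := avg _ _ _ _ => ta hb.
  have := dens w wW; set x := #|_|%:R; set y := #|_|%:R; move=> hxy.
  have x0 : 0 < x by apply: cyl0.
  have y0 : 0 <= y by rewrite /y.
  rewrite -(ler_pM2l x0); apply: le_trans hb.
  apply: le_trans (_ : y * (1 - theta) <= _); last by apply: ler_wpM2l.
  apply: le_trans (_ : x * (mu * (1 - theta)) <= _).
    by apply: ler_wpM2l => //; lra.
  rewrite mulrA; apply: ler_wpM2r; [lra | by rewrite mulrC].
have dlow w p : w \in W -> p0 <= p -> p < 1 ->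
    (1 - eps) * p <= avg p s (f w) set0.
  by move=> wW hp hp1; apply: (avg_lower p00 hp hp1 e0 e1 _ _ (dp0 w wW)).
move=> w wW.
(* The other d terms take at least d (1 - eps) q of the total d, and d - d q = q. *)
have hi : avg q s (f w) set0 <= q + d%:R * eps.
  have : \sum_(w' in W) avg q s (f w') set0 <= d%:R := sum_avg_up_le R cW k noF.
  rewrite (bigD1 w) //=.
  have : \sum_(w' in W | w' != w) ((1 - eps) * q) <=
     \sum_(w' in W | w' != w) avg q s (f w') set0.
    by apply: ler_sum => w' /andP[w'W _]; apply: dlow => //; lra.
  have -> : \sum_(w' in W | w' != w) ((1 - eps) * q) = d%:R * ((1 - eps) * q).
    transitivity (\sum_(a in W :\ w) ((1 - eps) * q)).
      by apply: eq_bigl => a; rewrite !inE andbC.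
    by rewrite sumr_const cWw // mulr_natl.
  set a := \sum_(_ in _ | _) _; set b := avg _ _ _ _.
  have qe : q * (d%:R + 1) = d%:R by rewrite natr1 /q divfK // pnatr_eq0.
  have : 0 <= eps * (1 - q) * d%:R by rewrite !mulr_ge0 //; lra.
  nra.
(* Weaker than the available (1 - eps) p1, so that the same error d eps serves on both sides. *)
have lo : p1 - d%:R * eps <= avg p1 s (f w) set0.
  apply: le_trans (dlow w p1 wW p0p1 ltac:(lra)).
  have : 0 <= eps * (d%:R - p1) by rewrite mulr_ge0 //; lra.
  lra.
have p10 : 0 <= p1 by lra.
have de0 : 0 <= d%:R * eps by rewrite mulr_ge0.
have [p [i [p1p pq iS hi']]] := influential_coordinate us (ndf w) (f01 w)
  p10 p1q (ltW q1) de0 v0 hv g0 g1 hg lo hi.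
exists i; first by move: iS; rewrite mem_enum inE.
have p01 : 0 <= p <= 1 by apply/andP; split; lra.
(* Here [up_density] is read as an upper bound: many members missing i would give them a large
   up-closure. The factor 2 in the conclusion pays for 1 - theta >= 1 / 2. *)
set G0 := [set B in _ | _].
have sG0 : G0 \subset cyl k W (W :\ w).
  by apply/subsetP => B; rewrite /G0 !inE => /andP[/andP[]].
have := @up_density R T p k W (W :\ w) G0 p01 (subD1set _ _).
rewrite cWw // => /(_ dk sG0).
rewrite -/s; have := tail p ltac:(lra) ltac:(lra).
set a := avg _ _ _ _ => ta hb.
have hc : avg p s (up R W G0) set0 <= gam.
  apply: le_trans hi'; apply: le_avg => // B _; exact: up_avoid.
have := ler_wpM2l (ltW (cyl0 w wW)) hc.
have := ler_wpM2l (ler0n R #|G0|) ta.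
have : 0 <= #|G0|%:R * (1 / 2 - theta) by rewrite mulr_ge0 //; lra.
lra.
Qed.

(** * Degrees and regular traces *)

Section Density.
Variables (R : realType) (T : finType) (k L : nat) (c : R).
Implicit Types (Z Q A B X : {set T}) (G F : {set {set T}}).

Local Notation n := (#|T|%:R).

Hypotheses (T_gt0 : (0 < #|T|)%N) (c_gt0 : 0 < c).
Hypothesis k_ge : c * n + L%:R <= k%:R.
Hypothesis k_le : k%:R + L%:R + c * n <= n.

(** The probability that a given point outside Z lies in a uniform member of [cyl k Z Q]. *)
Definition rho Z Q : R := (k%:R - #|Q|%:R) / (n - #|Z|%:R).

Let n_gt0 : 0 < n :> R. Proof. by rewrite ltr0n. Qed.
Let cn_gt0 : 0 < c * n. Proof. exact: mulr_gt0. Qed.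

Lemma slack Z Q : (#|Z| <= L)%N -> Q \subset Z ->
  [/\ (#|Q| < k)%N, (#|Z| < #|T|)%N & #|Q|%:R <= #|Z|%:R :> R].
Proof.
move=> ZL QZ; have QZ' := subset_leq_card QZ.
have h1 : #|Z|%:R <= L%:R :> R by rewrite ler_nat.
have h2 : #|Q|%:R <= #|Z|%:R :> R by rewrite ler_nat.
have k0 : 0 <= k%:R :> R by [].
have cn0 := cn_gt0; have kge := k_ge; have kle := k_le.
split=> //; rewrite -(ltr_nat R); lra.
Qed.

Lemma rho_bounds Z Q : (#|Z| <= L)%N -> Q \subset Z ->
  c <= rho Z Q /\ rho Z Q <= 1 - c.
Proof.
move=> ZL QZ; have [_ hZ hQZ] := slack ZL QZ.
have h1 : #|Z|%:R <= L%:R :> R by rewrite ler_nat.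
have N0 : 0 < n - #|Z|%:R :> R by rewrite subr_gt0 ltr_nat.
have : 0 <= c * #|Z|%:R by rewrite mulr_ge0 // ltW.
have : 0 <= #|Q|%:R :> R by [].
have cn0 := cn_gt0; have kge := k_ge; have kle := k_le.
rewrite /rho ler_pdivlMr // ler_pdivrMr // => *; split; lra.
Qed.

Lemma card_cyl_inE Z Q x : (#|Z| <= L)%N -> Q \subset Z -> x \notin Z ->
  #|cyl k (x |: Z) (x |: Q)|%:R = rho Z Q * #|cyl k Z Q|%:R.
Proof.
move=> ZL QZ xZ; have [hQ hZ _] := slack ZL QZ.
have := card_cyl_in xZ QZ hQ.
move/(congr1 (fun a : nat => a%:R : R)); rewrite !natrM (natrB _ (ltnW hZ)) (natrB _ (ltnW hQ)) => e.
have N0 : n - #|Z|%:R != 0 :> R by rewrite gt_eqF // subr_gt0 ltr_nat.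
by apply: (mulfI N0); rewrite e /rho mulrA [_ * (_ / _)]mulrC divfK.
Qed.

Lemma card_cyl_notinE Z Q x : (#|Z| <= L)%N -> Q \subset Z -> x \notin Z ->
  #|cyl k (x |: Z) Q|%:R = (1 - rho Z Q) * #|cyl k Z Q|%:R.
Proof.
move=> ZL QZ xZ; have := card_cyl_split k xZ QZ.
move/(congr1 (fun a : nat => a%:R : R)); rewrite natrD card_cyl_inE // => e.
by lra.
Qed.

(** Negative correlation: with [rho] = a / b, putting x into the trace lowers the ratio for y to (a
    - 1) / (b - 1) <= a / b, because a <= b. *)
Lemma card_cyl_in2 Z Q x y : (#|Z| < L)%N -> Q \subset Z ->
    x \notin Z -> y \notin Z -> x != y ->
  #|cyl k (y |: (x |: Z)) (y |: (x |: Q))|%:R <=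
    rho Z Q ^+ 2 * #|cyl k Z Q|%:R.
Proof.
have c0 := c_gt0; move=> ZL QZ xZ yZ xy; have ZL' := ltnW ZL.
have xQ : x \notin Q by apply: contra xZ; apply: (subsetP QZ).
have cxZ : #|x |: Z| = #|Z|.+1 by rewrite cardsU1 xZ.
have cxQ : #|x |: Q| = #|Q|.+1 by rewrite cardsU1 xQ.
have xZL : (#|x |: Z| <= L)%N by rewrite cxZ.
have xQZ : x |: Q \subset x |: Z by apply: setUS.
rewrite card_cyl_inE // ?card_cyl_inE // ?inE ?negb_or ?yZ ?andbT 1?eq_sym //.
rewrite mulrA expr2; apply: ler_wpM2r => //; apply: ler_wpM2r.
  by have [] := rho_bounds ZL' QZ; lra.
have [_ hZ1 _] := slack xZL xQZ; have [hQ hZ _] := slack ZL' QZ.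
have [_ r1] := rho_bounds ZL' QZ.
have N0 : 0 < n - #|Z|%:R :> R by rewrite subr_gt0 ltr_nat.
have N1 : 0 < n - #|x |: Z|%:R :> R by rewrite subr_gt0 ltr_nat.
rewrite /rho ler_pdivrMr // mulrAC ler_pdivlMr // cxZ cxQ.
have : k%:R - #|Q|%:R <= n - #|Z|%:R :> R.
  by move: r1; rewrite /rho ler_pdivrMr //; nra.
rewrite -!natr1; move: (k%:R) (#|Q|%:R) (#|Z|%:R) => a b e h.
by nra.
Qed.

Lemma card_cyl_gt0 Z Q : (#|Z| <= L)%N -> Q \subset Z -> (0 < #|cyl k Z Q|)%N.
Proof.
move=> ZL QZ; have [hQ hZ hQZ] := slack ZL QZ.
rewrite (card_cyl QZ (ltnW hQ)) bin_gt0.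
rewrite -(ler_nat R) (natrB _ (ltnW hZ)) (natrB _ (ltnW hQ)).
have h1 : #|Z|%:R <= L%:R :> R by rewrite ler_nat.
have : 0 <= #|Q|%:R :> R by [].
have cn0 := cn_gt0; have kge := k_ge; have kle := k_le.
lra.
Qed.

Definition good (mu : R) F Z := forall Q, Q \subset Z ->
  mu * #|cyl k Z Q|%:R <= #|F :&: cyl k Z Q|%:R.

Lemma card_refine Z Z' Q' (H : {set {set T}}) : Z' \subset Z ->
  #|H :&: cyl k Z' Q'| =
  (\sum_(Q in powerset Z | Q :&: Z' == Q') #|H :&: cyl k Z Q|)%N.
Proof.
move=> sZ; rewrite -sum1_card.
rewrite (partition_big (fun A => A :&: Z)
   (fun Q => (Q \in powerset Z) && (Q :&: Z' == Q'))) /=; last first.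
  move=> A; rewrite !inE => /and3P[_ _ /eqP <-]; rewrite subsetIr /=.
  by rewrite -setIA (setIidPr sZ).
apply: eq_bigr => Q; rewrite inE => /andP[QZ /eqP eQ].
rewrite -sum1_card; apply: eq_bigl => A; rewrite !inE -!andbA.
congr (_ && (_ && _)); apply/andP/eqP => [[_ /eqP //]|e].
by rewrite e eqxx -eQ -e -setIA (setIidPr sZ).
Qed.

(** A cylinder over Z' is the disjoint union of cylinders over Z. *)
Lemma good_sub mu F Z Z' : Z' \subset Z -> good mu F Z -> good mu F Z'.
Proof.
move=> sZ gZ Q' sQ'; rewrite (card_refine _ _ sZ).
rewrite -[cyl k Z' Q']setTI (card_refine _ _ sZ) !natr_sum mulr_sumr.
by apply: ler_sum => Q /andP[]; rewrite powersetE setTI => /gZ.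
Qed.

Lemma card_elem_sum G x : #|[set A in G | x \in A]| = (\sum_(A in G) (x \in A))%N.
Proof.
rewrite -sum1_card big_mkcond [RHS]big_mkcond; apply: eq_bigr => A _.
by rewrite inE; case: (A \in G); case: (x \in A).
Qed.

(** The diagonal terms are at most 1 each; the mixed terms sum to at most 0 by negative
    correlation. *)
Lemma second_moment Z Q X : (#|Z| < L)%N -> Q \subset Z -> X \subset ~: Z ->
  \sum_(A in cyl k Z Q) (\sum_(x in X) ((x \in A)%:R - rho Z Q)) ^+ 2
    <= #|X|%:R * #|cyl k Z Q|%:R.
Proof.
move=> ZL QZ XZ; have ZL' := ltnW ZL; set r := rho Z Q.
have c0 := c_gt0; have [r0 r1] := rho_bounds ZL' QZ; rewrite -/r in r0 r1.
under eq_bigr do rewrite expr2 mulr_suml.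
under eq_bigr do under eq_bigr do rewrite mulr_sumr.
rewrite exchange_big /= -sum1_card natr_sum mulr_suml.
apply: ler_sum => x xX; rewrite mul1r exchange_big /=.
have xZ : x \notin Z by have := subsetP XZ _ xX; rewrite inE.
have deg z : z \notin Z ->
    \sum_(A in cyl k Z Q) (z \in A)%:R = r * #|cyl k Z Q|%:R :> R.
  by move=> zZ; rewrite -(card_cyl_inE ZL' QZ zZ) cyl_in // card_elem_sum natr_sum.
rewrite (bigD1 x) //= -[leRHS]addr0; apply: lerD.
  rewrite -sum1_card natr_sum; apply: ler_sum => A _.
  by case: (x \in A) => /=; nra.
apply: sumr_le0 => y /andP[yX yx].
have yZ : y \notin Z by have := subsetP XZ _ yX; rewrite inE.
have e : \sum_(A in cyl k Z Q) (x \in A)%:R * (y \in A)%:R =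
   #|cyl k (y |: (x |: Z)) (y |: (x |: Q))|%:R :> R.
  rewrite cyl_in ?setUS ?inE ?negb_or ?yx // cyl_in //.
  rewrite card_elem_sum natr_sum big_mkcond [RHS]big_mkcond.
  apply: eq_bigr => A _; rewrite [in RHS]inE.
  by case: (A \in _); case: (x \in A); rewrite /= ?mulr1n ?mulr0n ?mul1r ?mul0r.
have := @card_cyl_in2 Z Q x y ZL QZ xZ yZ; rewrite eq_sym => /(_ yx).
rewrite -e -/r => h; clearbody r.
rewrite (eq_bigr (fun A => (x \in A)%:R * (y \in A)%:R - r * (x \in A)%:R
   - r * (y \in A)%:R + r ^+ 2)) => [|A _]; last by ring.
rewrite big_split /= !sumrB -!mulr_sumr !deg // sumr_const -mulr_natr.
lra.
Qed.

(** If all degrees in X deviate by h in the same direction, the sign being a = 1 or a = -1, the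
    deviations add up to |X| h over G, while their second moment over the whole cylinder is only
    linear in |X|. Cauchy-Schwarz then bounds |X|. *)
Lemma deviating_elements Z Q G X (a h : R) : (#|Z| < L)%N -> Q \subset Z ->
    X \subset ~: Z -> G \subset cyl k Z Q -> (0 < #|G|)%N -> 0 <= h -> a ^+ 2 = 1 ->
    {in X, forall x, h <= a * (#|[set A in G | x \in A]|%:R - rho Z Q * #|G|%:R)} ->
  #|X|%:R * h ^+ 2 <= #|cyl k Z Q|%:R * #|G|%:R.
Proof.
move=> ZL QZ XZ sG G0 h0 a2 dev; set r := rho Z Q.
pose g : R := #|G|%:R; have g0 : 0 < g by rewrite ltr0n.
pose M : R := #|X|%:R; have M0 : 0 <= M by [].
pose y A : R := a * \sum_(x in X) ((x \in A)%:R - r).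
have sumy : M * h <= \sum_(A in G) y A.
  rewrite /y -mulr_sumr exchange_big /= mulr_sumr.
  rewrite /M -sum1_card natr_sum mulr_suml; apply: ler_sum => x xX.
  rewrite mul1r; apply: le_trans (dev x xX) _.
  by rewrite sumrB sumr_const card_elem_sum natr_sum mulr_natr.
have sumy2 : \sum_(A in G) y A ^+ 2 <= M * #|cyl k Z Q|%:R.
  apply: le_trans (second_moment ZL QZ XZ); rewrite -/r.
  rewrite [leRHS](bigID (mem G)) /= -[leLHS]addr0; apply: lerD; last first.
    by apply: sumr_ge0 => A _; apply: sqr_ge0.
  rewrite le_eqVlt; apply/orP; left; apply/eqP.
  apply: eq_big => A; last by rewrite /y exprMn a2 mul1r.
  by case: (boolP (A \in G)) => [/(subsetP sG) ->|]; rewrite ?andbF.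
(* AM-GM: [2 l y <= y^2 + l^2], with the optimal [l]. *)
pose l := M * h / g.
have lg : l * g = M * h by rewrite /l divfK // gt_eqF.
have amgm : 2 * l * \sum_(A in G) y A <= \sum_(A in G) y A ^+ 2 + l ^+ 2 * g.
  rewrite mulr_sumr -subr_ge0.
  have -> : l ^+ 2 * g = \sum_(A in G) l ^+ 2 by rewrite sumr_const mulr_natr.
  rewrite -big_split /= -sumrB; apply: sumr_ge0 => A _.
  have -> : y A ^+ 2 + l ^+ 2 - 2 * l * y A = (y A - l) ^+ 2 by ring.
  exact: sqr_ge0.
have l0 : 0 <= l by rewrite divr_ge0 ?mulr_ge0 // ltW.
have h1 : 2 * l * (M * h) <= 2 * l * \sum_(A in G) y A.
  by apply: ler_wpM2l sumy; lra.
have h2 : l * (M * h) <= M * #|cyl k Z Q|%:R.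
  have : l ^+ 2 * g = l * (M * h) by rewrite expr2 -mulrA lg.
  lra.
rewrite -/M -/g; have [M_0|Mn] := eqVneq M 0.
  by rewrite M_0 mul0r mulr_ge0 // ltW.
have Mp : 0 < M by rewrite lt_def Mn.
rewrite -(ler_pM2l Mp).
have -> : M * (M * h ^+ 2) = l * (M * h) * g.
  by rewrite [RHS]mulrAC lg; ring.
by rewrite [leRHS]mulrA; apply: ler_wpM2r => //; rewrite ltW.
Qed.

Lemma leq_card_bigcup (J : finType) (P : pred J) (D : J -> {set T}) :
  (#|\bigcup_(j | P j) D j| <= \sum_(j | P j) #|D j|)%N.
Proof.
elim/big_rec2: _ => [|j m U _ h]; first by rewrite cards0.
by apply: leq_trans (leq_card_setU _ _) _; rewrite leq_add2l.
Qed.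

(** Each trace Q on Z and each sign rules out at most 1 / den points whose degree deviates by at
    least eta c times the size of the part of F with trace Q. For any other x, since [rho] and 1 -
    [rho] are both at least c, the density drops by a factor of at worst 1 - eta, whether x joins
    the trace or stays out. *)
Lemma good_step mu eta F Z Av : 0 < mu -> 0 < eta -> eta <= 1 -> (#|Z| < L)%N ->
    good mu F Z ->
    (2 ^ (#|Z|.+1))%:R / (eta ^+ 2 * c ^+ 2 * mu) < #|~: (Av :|: Z)|%:R ->
  exists2 x, x \notin Av :|: Z & good ((1 - eta) * mu) F (x |: Z).
Proof.
have c0 := c_gt0.
move=> mu0 eta0 eta1 ZL gZ big; have ZL' := ltnW ZL.
pose G Q := F :&: cyl k Z Q.
pose D a Q := [set x in ~: Z | eta * c * #|G Q|%:R <=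
  a * (#|[set A in G Q | x \in A]|%:R - rho Z Q * #|G Q|%:R)].
pose den := eta ^+ 2 * c ^+ 2 * mu.
have den0 : 0 < den by rewrite !mulr_gt0 ?exprn_gt0.
have C0 Q : Q \subset Z -> 0 < #|cyl k Z Q|%:R :> R.
  by move=> QZ; rewrite ltr0n card_cyl_gt0.
have g0 Q : Q \subset Z -> 0 < #|G Q|%:R :> R.
  by move=> QZ; apply: lt_le_trans (gZ Q QZ); rewrite mulr_gt0 ?C0.
have cardD a Q : a ^+ 2 = 1 -> Q \subset Z -> #|D a Q|%:R <= den^-1.
  move=> a2 QZ; rewrite -[leRHS]mul1r ler_pdivlMr //.
  have := @deviating_elements Z Q (G Q) (D a Q) a (eta * c * #|G Q|%:R) ZL QZ.
  move/(_ _ (subsetIr _ _) _ _ a2); rewrite -(ltr_nat R) g0 //.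
  have -> : 0 <= eta * c * #|G Q|%:R by rewrite !mulr_ge0 // ltW.
  have sub : D a Q \subset ~: Z by apply/subsetP => x; rewrite inE => /andP[].
  move/(_ sub isT isT) => h.
  have {}h : #|D a Q|%:R * (eta * c * #|G Q|%:R) ^+ 2 <=
    #|cyl k Z Q|%:R * #|G Q|%:R.
    by apply: h => x; rewrite inE => /andP[].
  have h1 := gZ Q QZ; rewrite -/(G Q) in h1.
  have x0 : 0 <= #|D a Q|%:R * eta ^+ 2 * c ^+ 2 by rewrite !mulr_ge0 // ltW.
  have h2 := ler_wpM2l x0 h1.
  have h3 : #|D a Q|%:R * eta ^+ 2 * c ^+ 2 * #|G Q|%:R <= #|cyl k Z Q|%:R.
    rewrite -(ler_pM2r (g0 Q QZ)); apply: le_trans h.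
    by rewrite le_eqVlt; apply/orP; left; apply/eqP; ring.
  rewrite -(ler_pM2r (C0 Q QZ)) mul1r; apply: le_trans h3.
  apply: le_trans h2; rewrite le_eqVlt /den; apply/orP; left; apply/eqP; ring.
pose U Q := D 1 Q :|: D (-1) Q.
pose bad := \bigcup_(Q in powerset Z) U Q.
have cbad : #|bad|%:R <= (2 ^ (#|Z|.+1))%:R / den.
  apply: (@le_trans _ _ (\sum_(Q in powerset Z) (#|D 1 Q|%:R + #|D (-1) Q|%:R))).
    apply: (@le_trans _ _ (\sum_(Q in powerset Z) #|U Q|)%:R).
      by rewrite ler_nat leq_card_bigcup.
    rewrite natr_sum; apply: ler_sum => Q _; rewrite -natrD ler_nat.
    exact: leq_card_setU.
  apply: (@le_trans _ _ (\sum_(Q in powerset Z) (2 / den))).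
    apply: ler_sum => Q; rewrite powersetE => QZ.
    have h1 := @cardD 1 Q (expr1n _ _) QZ.
    have h2 := @cardD (-1) Q ltac:(by rewrite sqrrN expr1n) QZ.
    by rewrite mulrDl mul1r; apply: lerD.
  by rewrite sumr_const card_powerset -[leLHS]mulr_natl mulrA -natrM expnSr.
have [x xN xbad] : exists2 x, x \in ~: (Av :|: Z) & x \notin bad.
  apply/subsetPn; apply/negP => /subset_leq_card; rewrite -(ler_nat R) => h.
  by have := lt_le_trans big (le_trans h cbad); rewrite ltxx.
exists x; first by rewrite inE in xN.
have xZ : x \notin Z by move: xN; rewrite !inE negb_or => /andP[].
have dev Q : Q \subset Z -> `|#|[set A in G Q | x \in A]|%:R - rho Z Q * #|G Q|%:R|
    <= eta * c * #|G Q|%:R.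
  move=> QZ; have : x \notin U Q.
    by apply: contra xbad => h; apply/bigcupP; exists Q => //; rewrite powersetE.
  rewrite !inE xZ /= mul1r mulN1r negb_or -!ltNge => /andP[h1 h2].
  by rewrite ler_norml; apply/andP; split; lra.
move=> Q' sQ'; case: (boolP (x \in Q')) => xQ'.
  have QZ : Q' :\ x \subset Z by rewrite subDset.
  rewrite -(setD1K xQ') (card_cyl_inE ZL' QZ xZ).
  have -> : F :&: cyl k (x |: Z) (x |: Q' :\ x) = [set A in G (Q' :\ x) | x \in A].
    by rewrite cyl_in //; apply/setP => A; rewrite !inE -!andbA.
  have := dev _ QZ; rewrite ler_norml => /andP[h1 _].
  have [r0 r1] := rho_bounds ZL' QZ.
  have h2 := gZ _ QZ; rewrite -/(G _) in h2.
  have gg := g0 _ QZ.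
  move: h1 h2 gg r0 r1 (C0 _ QZ); move: (rho _ _) (#|G _|%:R) (#|cyl k Z _|%:R).
  move: (#|_|%:R) => a r g C h1 h2 gg r0 r1 CC.
  have h3 : 0 <= (1 - eta) * r.
    by rewrite mulr_ge0 // ?subr_ge0 // (le_trans (ltW c0)).
  have := ler_wpM2l h3 h2.
  have : 0 <= eta * g * (r - c).
    by rewrite !mulr_ge0 ?subr_ge0 // ltW.
  lra.
have QZ : Q' \subset Z.
  apply/subsetP => y yQ; have := subsetP sQ' _ yQ; rewrite !inE.
  by case: (eqVneq y x) => // yx; rewrite -yx yQ in xQ'.
rewrite (card_cyl_notinE ZL' QZ xZ).
have e : #|F :&: cyl k (x |: Z) Q'|%:R =
    #|G Q'|%:R - #|[set A in G Q' | x \in A]|%:R :> R.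
  have := congr1 (fun a : nat => a%:R : R) (card_split_elem (G Q') x).
  rewrite natrD => <-; rewrite addrAC subrr add0r.
  congr (_%:R); apply: eq_card => A; rewrite cyl_notin // !inE.
  by rewrite -!andbA.
have := dev _ QZ; rewrite ler_norml => /andP[_ h1]; rewrite e.
have [r0 r1] := rho_bounds ZL' QZ.
have h2 := gZ _ QZ; rewrite -/(G _) in h2.
have gg := g0 _ QZ.
move: h1 h2 gg r0 r1 (C0 _ QZ) => {e}.
move: (#|[set A in _ | _]|%:R) (rho _ _) (#|G _|%:R) (#|cyl k Z _|%:R).
move=> a r g C h1 h2 gg r0 r1 CC.
have rc : c <= 1 - r by lra.
have h3 : 0 <= (1 - eta) * (1 - r).
  by rewrite mulr_ge0 ?subr_ge0 // -subr_ge0 (le_trans (ltW c0)).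
have := ler_wpM2l h3 h2.
have : 0 <= eta * g * (1 - r - c).
  by rewrite !mulr_ge0 ?subr_ge0 // ltW.
lra.
Qed.

(** [mumin] bounds all intermediate densities from below, so one bound on the number of excluded
    points serves all m steps; the summand m accounts for points already chosen. *)
Lemma good_extend mumin mu eta F Z Av m : 0 < mumin -> 0 < eta -> eta <= 1 ->
    (#|Z| + m <= L)%N -> good mu F Z -> mumin <= (1 - eta) ^+ m * mu ->
    (2 ^ L)%:R / (eta ^+ 2 * c ^+ 2 * mumin) + m%:R < #|~: (Av :|: Z)|%:R ->
  exists V : {set T}, [/\ #|V| = m, [disjoint V & Av :|: Z] &
    good ((1 - eta) ^+ m * mu) F (Z :|: V)].
Proof.
have c0 := c_gt0.
move=> mm0 eta0 eta1; elim: m => [|m IH] ZL gZ hmu big.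
  exists set0; rewrite cards0 setU0 expr0 mul1r; split=> //.
  by rewrite -setI_eq0 set0I.
have e1 : 0 <= 1 - eta by rewrite subr_ge0.
have hmu' : mumin <= (1 - eta) ^+ m * mu.
  have h0 : 0 <= (1 - eta) ^+ m * mu.
    rewrite leNgt; apply/negP => lt0.
    have := mulr_ge0_le0 e1 (ltW lt0); rewrite mulrA -exprS; lra.
  apply: le_trans hmu _; rewrite exprS -mulrA ler_piMl //; lra.
rewrite -natr1 in big.
have ZmL : (#|Z| + m < L)%N by rewrite -addnS.
have [|V [cV dV gV]] := IH (ltnW ZmL) gZ hmu'; first by lra.
have ZV : #|Z :|: V| = (#|Z| + m)%N.
  rewrite cardsU cV; have -> : Z :&: V = set0; last by rewrite cards0 subn0.
  apply/setP => x; rewrite !inE; apply/negP => /andP[xZ xV].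
  by have := disjointFr dV xV; rewrite inE xZ orbT.
have mu0 : 0 < (1 - eta) ^+ m * mu by apply: lt_le_trans hmu'.
have [||x xN gx] := @good_step _ eta F (Z :|: V) Av mu0 eta0 eta1 _ gV.
- by rewrite ZV.
- rewrite ZV.
  have h1 : (2 ^ (#|Z| + m).+1)%:R <= (2 ^ L)%:R :> R.
    by rewrite ler_nat leq_exp2l.
  have h2 : 0 < eta ^+ 2 * c ^+ 2 by rewrite mulr_gt0 ?exprn_gt0.
  apply: (@le_lt_trans _ _ ((2 ^ L)%:R / (eta ^+ 2 * c ^+ 2 * mumin))).
    apply: ler_pM => //; first by rewrite invr_ge0 mulr_ge0 // ltW.
    have h5 : 0 < eta ^+ 2 * c ^+ 2 * mumin by apply: mulr_gt0.
    have h6 : 0 < eta ^+ 2 * c ^+ 2 * ((1 - eta) ^+ m * mu) by apply: mulr_gt0.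
    rewrite lef_pV2 ?posrE //; apply: ler_wpM2l hmu'; exact: ltW.
  rewrite -(ltrD2r m%:R); apply: lt_le_trans (_ : #|~: (Av :|: Z)|%:R <= _).
    by move: big; rewrite addrA; lra.
  have -> : ~: (Av :|: (Z :|: V)) = ~: (Av :|: Z) :\: V.
    by rewrite setUA [~: (_ :|: V)]setCU setDE.
  rewrite -natrD ler_nat cardsD.
  have h3 : (#|~: (Av :|: Z) :&: V| <= m)%N by rewrite -cV subset_leq_card ?subsetIr.
  by clear -h3; lia.
exists (x |: V); split.
- rewrite cardsU1 cV; case: (boolP (x \in V)) => // xV.
  by move: xN; rewrite !inE xV !orbT.
- rewrite -setI_eq0; apply/eqP/setP => y; rewrite !inE; apply/negP.
  move=> /andP[/orP[/eqP ->|yV] h]; last first.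
    by have := disjointFr dV yV; rewrite inE h.
  by move: xN; rewrite !inE; case/orP: h => ->; rewrite ?orbT.
have -> : Z :|: (x |: V) = x |: (Z :|: V) by rewrite setUCA.
by rewrite exprS -mulrA.
Qed.

(** Each further prescribed point costs a factor [rho] or 1 - [rho], both at least c. *)
Lemma card_cyl_refine Z Z' Q' : Z \subset Z' -> (#|Z'| <= L)%N -> Q' \subset Z' ->
  c ^+ #|Z' :\: Z| * #|cyl k Z (Q' :&: Z)|%:R <= #|cyl k Z' Q'|%:R.
Proof.
have c0 := c_gt0.
move em : #|Z' :\: Z| => m; elim: m Z' Q' em => [|m IH] Z' Q' em sZ ZL' sQ.
  have e : Z' = Z.
    by apply/eqP; rewrite eqEsubset sZ andbT -setD_eq0 -cards_eq0 em.
  by rewrite e (setIidPl _) -?e // expr0 mul1r.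
have [x xD] : exists x, x \in Z' :\: Z by apply/card_gt0P; rewrite em.
have /setDP[xZ' xZ] := xD.
have sZx : Z \subset Z' :\ x by rewrite subsetD1 sZ.
have sQx : Q' :\ x \subset Z' :\ x by apply: setSD.
have ZxL : (#|Z' :\ x| <= L)%N.
  by apply: leq_trans ZL'; apply: subset_leq_card; apply: subD1set.
have cm : #|(Z' :\ x) :\: Z| = m.
  by move: em; rewrite (cardsD1 x) xD add1n => -[<-]; rewrite !setDDl setUC.
have := IH _ (Q' :\ x) cm sZx ZxL sQx.
have -> : (Q' :\ x) :&: Z = Q' :&: Z.
  by apply/setP => y; rewrite !inE; case: (eqVneq y x) => [->|]; rewrite ?(negbTE xZ) ?andbF.
move=> h; rewrite exprS -mulrA; apply: le_trans (ler_wpM2l (ltW c0) h) _.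
have xN : x \notin Z' :\ x by rewrite setD11.
have [r0 r1] := rho_bounds ZxL sQx.
case: (boolP (x \in Q')) => xQ.
  by rewrite -[in leRHS](setD1K xZ') -[in leRHS](setD1K xQ)
    (card_cyl_inE ZxL sQx xN) ler_wpM2r.
have eQ : Q' :\ x = Q' by apply/setDidPl; rewrite disjoint_sym disjoints1.
rewrite eQ in sQx r0 r1 *.
by rewrite -[in leRHS](setD1K xZ') (card_cyl_notinE ZxL sQx xN) ler_wpM2r //; lra.
Qed.

End Density.

(** * Completing a set outside a dense star *)

Lemma exists_superset_card (T : finType) (U S : {set T}) m :
    U \subset S -> (#|U| <= m)%N -> (m <= #|S|)%N ->
  exists D : {set T}, [/\ U \subset D, D \subset S & #|D| = m].
Proof.
move=> US Um mS; have cSU : #|S :\: U| = (#|S| - #|U|)%N.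
  by rewrite cardsD (setIidPr US).
have [|E ES cE] := @exists_subset_card T (S :\: U) (m - #|U|).
  by rewrite cSU leq_sub2r.
have UE0 : U :&: E = set0.
  apply/eqP; rewrite setI_eq0 disjoint_sym disjoints_subset.
  by apply: subset_trans ES _; rewrite setDE subsetIr.
exists (U :|: E); split; first exact: subsetUl.
  by rewrite subUset US (subset_trans ES) // subsetDl.
by rewrite cardsU UE0 cards0 subn0 cE subnKC.
Qed.

Lemma exists_cover (T J : finType) (S : {set T}) (l : nat) (I : {set J})
    (S' : {set T}) : (l <= #|S|)%N -> S' \subset S -> (#|S'| <= #|I| * l)%N ->
  exists C : J -> {set T},
    {in I, forall j, C j \subset S /\ #|C j| = l} /\
    {in S', forall x, exists2 j, j \in I & x \in C j}.
Proof.
move=> lS; move em : #|I| => m; elim: m I S' em => [|m IH] I S' em sS' hS'.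
  exists (fun=> set0); split=> [j jI|x xS'].
    by move/eqP: em; rewrite cards_eq0 => /eqP I0; rewrite I0 inE in jI.
  by move: hS'; rewrite mul0n leqn0 cards_eq0 => /eqP S0; rewrite S0 inE in xS'.
have [i iI] : exists i, i \in I by apply/card_gt0P; rewrite em.
have [U US' cU] := @exists_subset_card T S' (minn l #|S'|) (geq_minr _ _).
have [E [UE ES cE]] : exists E : {set T}, [/\ U \subset E, E \subset S & #|E| = l].
  by apply: exists_superset_card lS; rewrite ?(subset_trans US') // cU geq_minl.
have cI : #|I :\ i| = m by move: em; rewrite (cardsD1 i) iI add1n => -[].
have [||C [CS Ccov]] := IH (I :\ i) (S' :\: E) cI.
- by apply: subset_trans sS'; apply: subsetDl.
- apply: leq_trans (_ : #|S' :\: U| <= _)%N.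
    by apply: subset_leq_card; apply: setDS.
  rewrite cardsD (setIidPr US') cU; move: hS'; rewrite mulSn; lia.
exists (fun j => if j == i then E else C j); split=> [j jI|x xS'].
  by case: eqP => // /eqP ji; apply: CS; rewrite !inE ji.
case: (boolP (x \in E)) => xE; first by exists i; rewrite ?eqxx.
have [|j] := Ccov x; first by rewrite inE xE.
by rewrite !inE => /andP[ji jI] xC; exists j => //; rewrite (negbTE ji).
Qed.

Section DenseStar.
Variables (R : realType) (T : finType) (k L : nat) (c : R).
Hypotheses (T_gt0 : (0 < #|T|)%N) (c_gt0 : 0 < c).
Hypothesis k_ge : c * #|T|%:R + L%:R <= k%:R.
Hypothesis k_le : k%:R + L%:R + c * #|T|%:R <= #|T|%:R.

(* [A b], for [b] in [bs], is a candidate member of the star at [i] that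
   contains [i], [Y] and all of [bs] except [b]; reserving [Y] outside [B]
   makes the sizes match even when [d (n - k) = n]. *)
Lemma dense_star_simplex (d : nat) (F : {set {set T}}) (V B : {set T}) (v i : T) :
    (0 < d)%N -> (#|T| <= d * (#|T| - k))%N -> (#|V| + 2 * d + 2 <= L)%N ->
    v \in V -> i \notin V -> B \in F -> #|B| = k -> i \notin B ->
    [disjoint B & V] ->
    d%:R * #|cyl k (i |: V) (i |: V :\ v) :\: F|%:R <
      c ^+ (2 * d) * #|cyl k (i |: V) (i |: V :\ v)|%:R ->
  contains_simplex d F.
Proof.
have c0 := c_gt0; have kg := k_ge; have kl := k_le.
move=> d0 dn VL vV iV BF cB iB dBV dense.
have cn0 : 0 < c * #|T|%:R by rewrite mulr_gt0 // ltr0n.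
have Lk : (L <= k)%N by rewrite -(ler_nat R); lra.
have kLn : (k + L <= #|T|)%N by rewrite -(ler_nat R) natrD; lra.
have V1 : (0 < #|V|)%N by apply/card_gt0P; exists v.
have [bs bsB cbs] : exists2 bs : {set T}, bs \subset B & #|bs| = d.
  by apply: exists_subset_card; rewrite cB; clear -VL Lk; lia.
have ciV : #|i |: V| = #|V|.+1 by rewrite cardsU1 iV.
have [Y YN cY] : exists2 Y : {set T}, Y \subset ~: (B :|: (i |: V)) & #|Y| = d.
  apply: exists_subset_card; rewrite cardsCs setCK.
  have : (#|B :|: (i |: V)| <= k + #|V|.+1)%N.
    by rewrite -cB -ciV leq_card_setU.
  clear -VL kLn; lia.
pose Z := (i |: V) :|: (bs :|: Y).
have inB x : x \in B -> (x \in Y) = false /\ (x \in i |: V) = false.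
  move=> xB; split.
    by apply/negP => /(subsetP YN); rewrite !inE xB.
  rewrite !inE (disjointFr dBV xB) orbF.
  by apply: contraNF iB => /eqP <-.
have inY x : x \in Y -> (x \in i |: V) = false.
  by move/(subsetP YN); rewrite !inE negb_or => /andP[_ /negbTE].
have dbsY : bs :&: Y = set0.
  apply/setP => x; rewrite !inE; apply/negP => /andP[/(subsetP bsB)/inB[-> _]].
  by [].
have diV : (i |: V) :&: (bs :|: Y) = set0.
  apply/setP => x; rewrite in_setI [x \in bs :|: _]in_setU in_set0; apply/negP.
  move=> /andP[xiV /orP[/(subsetP bsB)/inB[_]|/inY]]; by rewrite xiV.
have cbsY : #|bs :|: Y| = (2 * d)%N.
  by rewrite cardsU dbsY cards0 subn0 cbs cY; clear; lia.
have cZ : #|Z| = (#|V| + 1 + 2 * d)%N.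
  by rewrite cardsU diV cards0 subn0 ciV cbsY; clear; lia.
have cS : #|~: Z| = (#|T| - (#|V| + 1 + 2 * d))%N.
  by rewrite cardsCs setCK cZ.
(* Within Z the set [A b] will miss just v and b, so [C b] must supply the other n - k - 2 missing
   points. The d sets can cover ~: Z because d (n - k - 2) >= n - 2 d and Z contains the 2 d points
   of bs and Y. *)
have [|||C [CS Ccov]] := @exists_cover T T (~: Z) (#|T| - k - 2) bs (~: Z).
- by rewrite cS; clear -VL Lk; lia.
- by [].
- by rewrite cbs cS; clear -dn VL Lk; nia.
pose Q b := (i |: V :\ v) :|: (Y :|: bs :\ b).
pose A b := Q b :|: (~: Z :\: C b).
have QZ b : Q b \subset Z.
  apply: setUSS; first by apply: setUS; apply: subD1set.
  by rewrite setUC setSU // subD1set.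
have Qtr b : Q b :&: (i |: V) = i |: V :\ v.
  apply/setP => x; rewrite /Q in_setI.
  rewrite [x \in _ :|: (Y :|: _)]in_setU [x \in Y :|: _]in_setU.
  case xiV : (x \in i |: V); last first.
    rewrite andbF; apply/esym/negbTE; apply: contraFN xiV.
    by apply/subsetP; apply: setUS; apply: subD1set.
  rewrite andbT; case: (boolP (x \in Y)) => [/inY|_]; first by rewrite xiV.
  case: (boolP (x \in bs :\ b)) => [|_]; last by rewrite !orbF.
  by rewrite inE => /andP[_ /(subsetP bsB)/inB[_]]; rewrite xiV.
have cQ b : b \in bs -> #|Q b| = (#|V| + 2 * d - 1)%N.
  move=> bbs; have c1 : #|i |: V :\ v| = #|V|.
    rewrite cardsU1 !inE (negbTE iV) andbF /= add1n.
    by rewrite [in RHS](cardsD1 v) vV add1n.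
  have c2 : #|Y :|: bs :\ b| = (2 * d - 1)%N.
    rewrite cardsU cY; have -> : Y :&: (bs :\ b) = set0.
      by apply/eqP; rewrite -subset0 -dbsY setIC setSI // subD1set.
    rewrite cards0 subn0; have : #|bs| = (#|bs :\ b|).+1.
      by rewrite (cardsD1 b) bbs.
    rewrite cbs; clear -d0; lia.
  rewrite cardsU c1 c2; have -> : (i |: V :\ v) :&: (Y :|: bs :\ b) = set0.
    apply/eqP; rewrite -subset0 -diV; apply: setISS.
      by apply: setUS; apply: subD1set.
    by rewrite setUC setSU // subD1set.
  by rewrite cards0 subn0; clear -d0 V1; lia.
have AZ b : A b :&: Z = Q b.
  rewrite /A setIUl (setIidPl (QZ b)).
  have -> : (~: Z :\: C b) :&: Z = set0; last by rewrite setU0.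
  apply/setP => x; rewrite in_setI in_setD in_setC in_set0.
  by case: (x \in Z); rewrite ?andbF.
have Acyl b : b \in bs -> A b \in cyl k Z (Q b).
  move=> bbs; rewrite in_cyl AZ eqxx andbT.
  have [CSb cCb] := CS b bbs.
  rewrite cardsU (cQ b bbs) cardsD (setIidPr CSb) cS cCb.
  have -> : Q b :&: (~: Z :\: C b) = set0.
    apply/setP => x; rewrite in_setI in_set0; apply/negP => /andP[xQ].
    by rewrite in_setD in_setC (subsetP (QZ b) _ xQ) andbF.
  by rewrite cards0 subn0; apply/eqP; clear -VL Lk kLn V1; lia.
have ZL : (#|Z| <= L)%N by rewrite cZ; clear -VL; lia.
(* A single permutation moves all [A b], so the images of the [C b] still cover ~: Z. Each image of
   [A b] is uniform on its cylinder and falls outside F with probability below 1 / d, the factor c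
   ^+ (2 * d) paying for the refinement of the trace from i |: V to Z. A union bound over bs then
   applies. *)
pose P := [set sigma : {perm T} | perm_on (~: Z) sigma].
have P0 : 0 < #|P|%:R :> R.
  by rewrite ltr0n; apply/card_gt0P; exists 1%g; rewrite inE perm_on1.
pose bad b := [set sigma : {perm T} | perm_on (~: Z) sigma &
  sigma @: A b \in cyl k Z (Q b) :\: F].
have few b : b \in bs -> d%:R * #|bad b|%:R < #|P|%:R :> R.
  move=> bbs.
  have e := card_perm_imset_in (Acyl b bbs) (subsetDl (cyl k Z (Q b)) F).
  move/(congr1 (fun a : nat => a%:R : R)): e; rewrite !natrM -/(bad b) -/P => e.
  have sub : cyl k Z (Q b) :\: F \subset cyl k (i |: V) (i |: V :\ v) :\: F.
    apply/subsetP => X; rewrite !in_setD !in_cyl.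
    move=> /and3P[-> -> /eqP XZ] /=; rewrite -(Qtr b) -XZ -setIA; apply/eqP.
    by congr (_ :&: _); apply/esym/setIidPr; apply: subsetUl.
  have ref := card_cyl_refine T_gt0 c_gt0 k_ge k_le (subsetUl (i |: V) _) ZL (QZ b).
  rewrite Qtr in ref.
  have cD : #|Z :\: (i |: V)| = (2 * d)%N.
    rewrite /Z setDUl setDv set0U -cbsY; congr #|pred_of_set _|.
    by apply/setDidPl; rewrite disjoint_sym -setI_eq0 diV.
  rewrite cD in ref; have := subset_leq_card sub; rewrite -(ler_nat R) => hsub.
  have lt := lt_le_trans dense ref.
  have cz : 0 < #|cyl k Z (Q b)|%:R :> R by apply: le_lt_trans lt; rewrite mulr_ge0.
  rewrite -(ltr_pM2r cz) -mulrA e.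
  rewrite mulrA [ltRHS]mulrC ltr_pM2r //; apply: le_lt_trans lt.
  by apply: ler_wpM2l.
have [sigma sP sgood] : exists2 sigma, sigma \in P & sigma \notin \bigcup_(b in bs) bad b.
  apply/subsetPn; apply/negP => /subset_leq_card sub.
  have := leq_trans sub (leq_card_bigcup _ _); rewrite -(ler_nat R) natr_sum => h.
  have dR : 0 < d%:R :> R by rewrite ltr0n.
  have [b0 b0bs] : exists b, b \in bs by apply/card_gt0P; rewrite cbs.
  have : \sum_(b in bs) d%:R * #|bad b|%:R < \sum_(b in bs) #|P|%:R :> R.
    by apply: ltr_sum => [|b /few //]; apply/hasP; exists b0; rewrite ?mem_index_enum.
  rewrite -mulr_sumr sumr_const cbs -[ltRHS]mulr_natl ltr_pM2l // => h'.
  by have := le_lt_trans h h'; rewrite ltxx.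
rewrite inE in sP.
have AF b : b \in bs -> sigma @: A b \in F /\ sigma @: A b :&: Z = Q b.
  move=> bbs; have hc := perm_cyl sP (Acyl b bbs); split.
    apply/negPn/negP => h; move/negP: sgood; apply.
    by apply/bigcupP; exists b => //; rewrite inE sP in_setD h hc.
  by move: hc; rewrite in_cyl => /andP[_ /eqP].
(* [None] stands for B and [Some b] for the image of [A b]. Omitting B leaves the common point i,
   the default of [odflt]; omitting the image of [A b] leaves b. *)
pose I : {set option T} := None |: Some @: bs.
pose X (o : option T) := if o is Some b then sigma @: A b else B.
apply: (@contains_simplexI T (option T) d F I X (odflt i)).
- rewrite cardsU1 card_imset ?cbs; last by move=> ? ? [].
  by have -> : None \notin Some @: bs by apply/imsetP => -[].
- move=> o; rewrite !inE => /orP[/eqP -> //|/imsetP[b bbs ->]] /=.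
  by have [] := AF b bbs.
- have mem b x : b \in bs -> x \in Q b -> x \in sigma @: A b.
    by move=> bbs; have [_ <-] := AF b bbs; rewrite inE => /andP[].
  move=> o o'; rewrite !inE => /orP[/eqP ->|/imsetP[b bbs ->]].
    move=> /orP[/eqP -> //|/imsetP[b bbs ->] _] /=.
    by apply: mem => //; rewrite /Q !inE eqxx.
  move=> /orP[/eqP -> _|/imsetP[b' b'bs ->] neq] /=.
    exact: subsetP bsB _ bbs.
  apply: mem => //; rewrite /Q !inE bbs andbT.
  have -> : b != b' by apply: contraNneq neq => ->.
  by rewrite !orbT.
move=> x; case: (boolP (x \in B)) => xB; last first.
  by exists None => //; rewrite !inE eqxx.
have [xY xiV] := inB x xB.
case: (boolP (x \in bs)) => xbs.
  exists (Some x); first by rewrite !inE imset_f ?orbT.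
  rewrite /=; have [_ e] := AF x xbs; apply/negP => xA.
  have xZ : x \in Z by rewrite /Z in_setU [x \in bs :|: _]in_setU xbs orbT.
  have : x \in Q x by rewrite -e inE xA.
  rewrite /Q in_setU [x \in Y :|: _]in_setU xY in_setD1 eqxx /= orbF => h.
  by move: xiV; rewrite (subsetP _ _ h) //; apply: setUS; apply: subD1set.
have xS : x \in ~: Z by rewrite in_setC /Z in_setU xiV in_setU (negbTE xbs) xY.
have yS : (sigma^-1)%g x \in ~: Z.
  by have := perm_closed (sigma^-1%g x) sP; rewrite permKV xS => <-.
have [b bbs hC] := Ccov _ yS; exists (Some b).
  by rewrite !inE imset_f ?orbT.
apply/imsetP => -[y yA ey]; move: hC; rewrite ey permK => hC.
move: yS; rewrite ey permK => yS.
move: yA; rewrite /A in_setU => /orP[/(subsetP (QZ b)) yZ|].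
  by move: yS; rewrite inE yZ.
by rewrite in_setD hC.
Qed.

End DenseStar.

(** * The star theorem *)

Section Star.
Variables (R : realType) (T : finType) (d k : nat) (F : {set {set T}}).
Variables (c gam v del h : R).
Local Notation n := (#|T|%:R).
Local Notation L := (4 * d + 4)%N.
Local Notation kap := (k%:R / #|T|%:R).

Hypotheses (d_gt0 : (0 < d)%N) (T_gt0 : (0 < #|T|)%N).
Hypotheses (c_gt0 : 0 < c) (cd_le1 : 4 * c * d%:R <= 1).
Hypothesis k_ge : 4 * c * n <= k%:R.
Hypothesis k_le : d%:R * k%:R <= (d%:R - 1) * n :> R.
(** [gam] absorbs the powers of c lost in refining traces. [v] is c (1 - q), a lower bound for p1 (1
    - q). [del] is the length of the interval below q on which the mean value theorem is used. [h]
    is the tolerated loss of density, chosen so that 3 h d / del = gam / 16. The equations are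
    cleared of denominators for linear arithmetic. *)
Hypothesis gamE : gam * (8 * d%:R) = c ^+ (2 * d + 3).
Hypothesis vE : v * (d%:R + 1) = c.
Hypothesis delE : del * 8 = gam * v.
Hypothesis hE : h * (48 * d%:R) = gam * del.
Hypothesis n_ge1 : L%:R <= c * n.
Hypothesis n_ge2 : 4 * (d%:R + 1) <= c * h * n.
Hypothesis n_ge3 : 1 <= 4 * c ^+ 2 * h ^+ 3 * n.
Hypothesis noF : ~ contains_simplex d F.

Lemma d_ge1 : 1 <= d%:R :> R. Proof. by rewrite ler1n. Qed.

Lemma n_gt0 : 0 < n :> R. Proof. by rewrite ltr0n. Qed.

Lemma c_le : c <= 1 / 4.
Proof.
have c0 := c_gt0; have cd := cd_le1.
have : c * 1 <= c * d%:R by rewrite ler_pM2l // d_ge1.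
lra.
Qed.

Lemma gam_gt0 : 0 < gam.
Proof.
have d8 : 0 < 8 * d%:R :> R by have := d_ge1; lra.
by rewrite -(pmulr_lgt0 _ d8) gamE exprn_gt0.
Qed.

Lemma gam_pow m : (m <= 2 * d + 3)%N -> 8 * d%:R * gam <= c ^+ m.
Proof.
move=> hm; rewrite mulrC gamE; apply: ler_wiXn2l => //; first exact: ltW.
by have := c_le; lra.
Qed.

Lemma gam_le m : (m <= 2 * d + 3)%N -> 8 * gam <= c ^+ m.
Proof.
move=> hm; apply: le_trans (gam_pow hm).
have := d_ge1; have := gam_gt0; nra.
Qed.

Lemma gam_le2 : 8 * gam <= c ^+ 2.
Proof. by apply: gam_le; clear; lia. Qed.

Lemma v_gt0 : 0 < v.
Proof.
have d1 : 0 < d%:R + 1 :> R by have := d_ge1; lra.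
by rewrite -(pmulr_lgt0 _ d1) vE.
Qed.

Lemma v_le : v <= c.
Proof. by rewrite -vE; have := d_ge1; have := v_gt0; nra. Qed.

Lemma del_gt0 : 0 < del.
Proof. by rewrite -(@pmulr_lgt0 _ 8) // delE mulr_gt0 ?gam_gt0 ?v_gt0. Qed.

Lemma del_le : 8 * del <= v.
Proof.
rewrite mulrC delE; have := @gam_le 0 isT; rewrite expr0 => g8.
have := v_gt0; have := gam_gt0; nra.
Qed.

Lemma h_gt0 : 0 < h.
Proof.
have d1 : 0 < 48 * d%:R :> R by have := d_ge1; lra.
by rewrite -(pmulr_lgt0 _ d1) hE mulr_gt0 ?gam_gt0 ?del_gt0.
Qed.

Lemma h_le : h <= gam /\ h <= del.
Proof.
have d1 := d_ge1; have h0 := h_gt0; have g0 := gam_gt0; have dl0 := del_gt0.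
have := @gam_le 0 isT; rewrite expr0 => g8.
have dl8 := del_le; have vc := v_le; have c4 := c_le; have he := hE.
have h48 : h <= gam * del by rewrite -he; nra.
by split; apply: le_trans h48 _; nra.
Qed.

Lemma kap_ge : 4 * c <= kap.
Proof. by rewrite ler_pdivlMr ?n_gt0. Qed.

Lemma kap_n : kap * n = k%:R :> R.
Proof. by rewrite divfK // gt_eqF // n_gt0. Qed.

Lemma kap_le : d%:R * kap <= d%:R - 1 :> R.
Proof. by rewrite mulrA ler_pdivrMr ?n_gt0. Qed.

Lemma kap_le1 : 4 * c <= 1 - kap.
Proof.
have d0 : 0 < d%:R :> R by rewrite ltr0n.
rewrite -(ler_pM2l d0) mulrBr; have := kap_le; have := cd_le1; lra.
Qed.

Lemma room1 : c * n + L%:R <= k%:R.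
Proof.
have := n_ge1; have := k_ge; have cn : 0 < c * n by rewrite mulr_gt0 ?n_gt0.
lra.
Qed.

Lemma room2 : k%:R + L%:R + c * n <= n.
Proof.
have := n_ge1; have cn : 0 < c * n by rewrite mulr_gt0 ?n_gt0.
have := ler_wpM2r (ltW n_gt0) kap_le1; rewrite mulrBl kap_n; lra.
Qed.

Lemma good_centre (W : {set T}) : #|W| = d.+1 -> good k ((1 - h) * kap) F W ->
  forall w, w \in W -> exists2 i, i \notin W &
    #|[set B in F :&: cyl k W (W :\ w) | i \notin B]|%:R <=
      2 * gam * #|cyl k W (W :\ w)|%:R.
Proof.
have d1 := d_ge1; have c0 := c_gt0; have c4 := c_le; have g0 := gam_gt0.
have v0 := v_gt0; have vc := v_le; have dl0 := del_gt0; have dl8 := del_le.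
have h0 := h_gt0; have [hg hdl] := h_le; have kg := kap_ge; have kl := kap_le.
have := @gam_le 0 isT; rewrite expr0 => g8.
have r1 := room1; have r2 := room2; have n0 := n_gt0.
have cn0 : 0 < c * n by rewrite mulr_gt0.
move=> cW gW.
pose q : R := d%:R / d.+1%:R.
have qE : q * (d%:R + 1) = d%:R by rewrite natr1 /q divfK // pnatr_eq0.
have q1E : (1 - q) * (d%:R + 1) = 1 by rewrite mulrBl qE; ring.
have q1 : q < 1.
  have : 0 < (1 - q) * (d%:R + 1) by rewrite q1E ltr01.
  by rewrite pmulr_lgt0; lra.
have dk : (d + d.+1 <= k)%N.
  apply: leq_trans (_ : L <= _)%N; first by clear; lia.
  by rewrite -(ler_nat R); lra.
(* The gap comes from d / (d + 1) - (d - 1) / d = 1 / (d (d + 1)). *)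
have qk : 4 * v <= q - kap.
  have dd : 0 < d%:R * (d%:R + 1) :> R by rewrite mulr_gt0; lra.
  rewrite -(ler_pM2r dd).
  have -> : 4 * v * (d%:R * (d%:R + 1)) = 4 * c * d%:R.
    by rewrite -[in RHS]vE; ring.
  have -> : (q - kap) * (d%:R * (d%:R + 1)) =
    d%:R * (q * (d%:R + 1)) - (d%:R * kap) * (d%:R + 1) by ring.
  rewrite qE; apply: le_trans cd_le1 _.
  have : d%:R * kap * (d%:R + 1) <=
    (d%:R - 1) * (d%:R + 1) :> R by apply: ler_wpM2r; lra.
  lra.
have ch : 4 * (c * h) <= h.
  have : 0 <= h * (1 - 4 * c) by rewrite mulr_ge0; lra.
  lra.
have ch0 : 0 < c * h by rewrite mulr_gt0.
have dn : (d.+1 <= #|T|)%N.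
  apply: leq_trans (_ : L <= _)%N; first by clear; lia.
  by rewrite -(ler_nat R); have : 0 <= k%:R :> R by []; lra.
have p0lt1 : kap + 4 * (c * h) <= 1 by lra.
(* The slack 4 c h n in p0 n covers the Chebyshev deviation 2 c h n and the d + 1 points of W. In 3
   h, one h each is due to the density of F, to the tail event and to p0 <= kap (1 + h). *)
apply: (@exists_centre R T d k W F ((1 - h) * kap) (2 * (c * h * n)) h
  (kap + 4 * (c * h)) (q - del) (3 * h) v gam) => //.
- exact: leq_trans (leq_addr _ _) dk.
- by move=> w wW; apply: gW; apply: subD1set.
- by rewrite !mulr_gt0.
- rewrite !natrB //; last exact: leq_trans (leq_addr _ _) dk.
  have -> : (kap + 4 * (c * h)) * (n - d.+1%:R) =
    kap * n + 4 * (c * h * n) - (kap + 4 * (c * h)) * d.+1%:R by ring.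
  rewrite kap_n -natr1.
  have : (kap + 4 * (c * h)) * (d%:R + 1) <= 1 * (d%:R + 1).
    by apply: ler_wpM2r; lra.
  have := n_ge2; lra.
- have t0 : 0 < (2 * (c * h * n)) ^+ 2 by rewrite exprn_gt0 // !mulr_gt0.
  rewrite ler_pdivrMr //.
  apply: (@le_trans _ _ n); first by rewrite ler_nat leq_subr.
  have -> : h * (2 * (c * h * n)) ^+ 2 = n * (4 * c ^+ 2 * h ^+ 3 * n) by ring.
  by rewrite ler_peMr ?n_ge3 // ltW.
- lra.
- lra.
- lra.
- rewrite -/q; lra.
- lra.
- lra.
- have h1 : kap + 4 * (c * h) <= kap * (1 + h).
    have : 4 * c * h <= kap * h by rewrite ler_pM2r.
    lra.
  apply: le_trans (_ : (1 - 3 * h) * (kap * (1 + h)) <= _).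
    by apply: ler_wpM2l => //; lra.
  have -> : (1 - h) * kap * (1 - h) = (1 - 3 * h) * (kap * (1 + h)) +
     kap * (4 * h ^+ 2) by ring.
  have kap0 : 0 <= kap :> R by lra.
  by rewrite lerDl; apply: mulr_ge0 => //; apply: mulr_ge0 => //; apply: sqr_ge0.
- have d10 : 0 < d%:R + 1 :> R by lra.
  rewrite -(ler_pM2r d10) vE -mulrA q1E; lra.
- exact: ltW.
- lra.
rewrite -/q; have -> : q - (q - del) = del by ring.
have -> : d%:R * (3 * h) = gam * del / 16 by rewrite -hE; field.
have -> : gam * del / 16 / del = gam / 16 by field; rewrite gt_eqF.
have -> : gam * del / 16 = del / 16 * gam by ring.
have e1 : del * gam <= del.
  by rewrite ler_piMr ?ltW //; lra.
have e2 := delE; have gv : 0 < gam * v by rewrite mulr_gt0.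
lra.
Qed.

Lemma rho_le (Z Q : {set T}) : (#|Z| <= 2 * d + 2)%N -> Q \subset Z ->
  rho R k Z Q <= kap + h.
Proof.
move=> hZ QZ; have h0 := h_gt0; have c4 := c_le; have c0 := c_gt0.
have n0 := n_gt0; have kl1 := kap_le1; have n2 := n_ge2; have kn := kap_n.
have [hg hdl] := h_le; have := @gam_le 0 isT; rewrite expr0 => g8.
have ZL : (#|Z| <= L)%N by apply: leq_trans hZ _; clear; lia.
have [_ hZT _] := slack T_gt0 c_gt0 room1 room2 ZL QZ.
have N0 : 0 < n - #|Z|%:R :> R by rewrite subr_gt0 ltr_nat.
have hZ' : #|Z|%:R <= 2 * (d%:R + 1) :> R.
  move: hZ; rewrite -(ler_nat R) natrD natrM; lra.
have z0 : 0 <= #|Z|%:R :> R by [].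
have hn : c * h * n <= h * n.
  by apply: ler_wpM2r; [exact: ltW | rewrite ler_piMl ?ltW //; lra].
rewrite /rho ler_pdivrMr //.
have -> : (kap + h) * (n - #|Z|%:R) = kap * n + h * n - (kap + h) * #|Z|%:R by ring.
have : (kap + h) * #|Z|%:R <= 2 * #|Z|%:R by apply: ler_wpM2r => //; lra.
have : 0 <= #|Q|%:R :> R by [].
lra.
Qed.

(** Prescribing d + 1 more points shrinks the cylinder by at worst c^(d + 1), and 8 gam <= c^(d +
    3). Centres found on two different sets can thus be compared on one common cylinder. *)
Lemma few_refine (U Z Q : {set T}) i : U \subset Z -> #|Z :\: U| = d.+1 ->
    (#|Z| <= L)%N -> Q \subset Z ->
    #|[set B in F :&: cyl k U (Q :&: U) | i \notin B]|%:R <=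
      2 * gam * #|cyl k U (Q :&: U)|%:R ->
  #|[set B in F :&: cyl k Z Q | i \notin B]|%:R <=
    c ^+ 2 / 4 * #|cyl k Z Q|%:R.
Proof.
move=> UZ cZU ZL QZ few.
have := card_cyl_refine T_gt0 c_gt0 room1 room2 UZ ZL QZ; rewrite cZU => ref.
have cp : 0 < c ^+ d.+1 by rewrite exprn_gt0 // c_gt0.
have sub : [set B in F :&: cyl k Z Q | i \notin B] \subset
   [set B in F :&: cyl k U (Q :&: U) | i \notin B].
  apply/subsetP => B; rewrite !in_set => /andP[/andP[-> /andP[-> /eqP <-]] ->].
  by rewrite -setIA (setIidPr UZ) eqxx.
have := subset_leq_card sub; rewrite -(ler_nat R) => h1.
have h2 := le_trans h1 few.
have g1 : 8 * gam <= c ^+ d.+1 * c ^+ 2.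
  by rewrite -exprD; apply: gam_le; have := d_gt0; clear; lia.
rewrite -(ler_pM2l cp).
apply: le_trans (ler_wpM2l (ltW cp) h2) _.
have h3 : 2 * gam * (c ^+ d.+1 * #|cyl k U (Q :&: U)|%:R) <=
    2 * gam * #|cyl k Z Q|%:R.
  by apply: ler_wpM2l ref; have := gam_gt0; lra.
have h4 : 8 * gam * #|cyl k Z Q|%:R <= c ^+ d.+1 * c ^+ 2 * #|cyl k Z Q|%:R.
  exact: ler_wpM2r.
lra.
Qed.

(* Otherwise almost all members with the common trace would contain both [i]
   and [i'], which only a fraction of about [(k / n)^2] of the k-sets do. *)
Lemma centre_unique (W V : {set T}) (w0 v0 i i' : T) :
    #|W| = d.+1 -> #|V| = d.+1 -> [disjoint V & W] ->
    good k ((1 - h) * kap) F (W :|: V) -> w0 \in W -> v0 \in V ->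
    i \notin W -> i \notin V -> i' \notin V ->
    #|[set B in F :&: cyl k W (W :\ w0) | i \notin B]|%:R <=
      2 * gam * #|cyl k W (W :\ w0)|%:R ->
    #|[set B in F :&: cyl k V (V :\ v0) | i' \notin B]|%:R <=
      2 * gam * #|cyl k V (V :\ v0)|%:R ->
  i = i'.
Proof.
have c0 := c_gt0; have c4 := c_le; have h0 := h_gt0; have [hg hdl] := h_le.
have kg := kap_ge; have kl1 := kap_le1; have d0 := d_gt0.
have g2 := gam_le2; have g0 := gam_gt0.
move=> cW cV dVW gZ wW vV iW iV i'V fewW fewV.
set Z := W :|: V in gZ; pose Q w := (W :\ w) :|: (V :\ v0).
have QZ w : Q w \subset Z by apply: setUSS; apply: subD1set.
have WV0 : W :&: V = set0 by apply/eqP; rewrite setI_eq0 disjoint_sym.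
have cZ : #|Z| = (2 * d + 2)%N.
  by rewrite cardsU WV0 cards0 subn0 cW cV; clear; lia.
have ZL : (#|Z| <= L)%N by rewrite cZ; clear; lia.
have ZL' : (#|Z| < L)%N by rewrite cZ; move: d0; clear; lia.
have QW w : Q w :&: W = W :\ w.
  rewrite /Q setIUl [(W :\ w) :&: W](setIidPl _) ?subD1set //.
  suff -> : (V :\ v0) :&: W = set0 by rewrite setU0.
  by apply/eqP; rewrite -subset0 -WV0 setIC setIS // subD1set.
have QV w : Q w :&: V = V :\ v0.
  rewrite /Q setIUl [(V :\ v0) :&: V](setIidPl _) ?subD1set //.
  suff -> : (W :\ w) :&: V = set0 by rewrite set0U.
  by apply/eqP; rewrite -subset0 -WV0 setSI // subD1set.
have cZW : #|Z :\: W| = d.+1.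
  rewrite /Z setDUl setDv set0U; have /setDidPl -> : [disjoint V & W] by [].
  exact: cV.
have cZV : #|Z :\: V| = d.+1.
  rewrite /Z setDUl setDv setU0.
  have /setDidPl -> : [disjoint W & V] by rewrite disjoint_sym.
  exact: cW.
have C0 w : 0 < #|cyl k Z (Q w)|%:R :> R.
  by rewrite ltr0n; apply: (card_cyl_gt0 T_gt0 c_gt0 room1 room2).
have missW : #|[set B in F :&: cyl k Z (Q w0) | i \notin B]|%:R <=
    c ^+ 2 / 4 * #|cyl k Z (Q w0)|%:R.
  by apply: few_refine cZW ZL (QZ w0) _; rewrite ?QW // subsetUl.
have missV w : #|[set B in F :&: cyl k Z (Q w) | i' \notin B]|%:R <=
    c ^+ 2 / 4 * #|cyl k Z (Q w)|%:R.
  by apply: few_refine cZV ZL (QZ w) _; rewrite ?QV // subsetUr.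
have cc : c ^+ 2 <= c / 4 by rewrite expr2 -[leRHS]mulrC ler_wpM2r //; lra.
have hc : 8 * h <= c ^+ 2 by lra.
have hk : h * kap <= h by rewrite ler_piMr; lra.
(* If i' lies in W, the trace that omits i' itself has no member containing i', against [missV] at w
   = i'; this is why [missV] is proved for every w. *)
case: (boolP (i' \in W)) => i'W.
  have e : [set B in F :&: cyl k Z (Q i') | i' \notin B] = F :&: cyl k Z (Q i').
    apply/setP => B; rewrite in_set; case: (boolP (B \in _)) => //=.
    rewrite in_setI in_cyl => /and3P[_ _ /eqP eB]; apply/negP => iB.
    have : i' \in Q i' by rewrite -eB !inE iB i'W.
    by rewrite !inE eqxx (negbTE i'V) andbF.
  have := missV i'; rewrite e => h1; have h2 := le_trans (gZ _ (QZ i')) h1.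
  by exfalso; move: h2; rewrite ler_pM2r //; lra.
apply/eqP/negPn/negP => neq.
have iZ : i \notin Z by rewrite inE negb_or iW.
have i'Z : i' \notin Z by rewrite inE negb_or i'W.
have hboth := @card_cyl_in2 R T k L c T_gt0 c_gt0 room1 room2 Z (Q w0) i i'
  ZL' (QZ w0) iZ i'Z neq.
have cover : F :&: cyl k Z (Q w0) \subset
    [set B in F :&: cyl k Z (Q w0) | i \notin B] :|:
    ([set B in F :&: cyl k Z (Q w0) | i' \notin B] :|:
     cyl k (i' |: (i |: Z)) (i' |: (i |: Q w0))).
  have i'iZ : i' \notin i |: Z by rewrite in_setU1 negb_or eq_sym neq.
  apply/subsetP => B hB; rewrite cyl_in ?setUS // cyl_in //.
  move: hB; rewrite in_setI in_cyl => /andP[BF /andP[Bk BQ]].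
  rewrite !in_setU !in_set BF Bk BQ /=.
  by case: (i \in B); case: (i' \in B).
have h1 : #|F :&: cyl k Z (Q w0)|%:R <=
    c ^+ 2 / 4 * #|cyl k Z (Q w0)|%:R + (c ^+ 2 / 4 * #|cyl k Z (Q w0)|%:R +
    rho R k Z (Q w0) ^+ 2 * #|cyl k Z (Q w0)|%:R).
  apply: le_trans (lerD missW (lerD (missV w0) hboth)).
  rewrite -!natrD ler_nat; apply: leq_trans (subset_leq_card cover) _.
  apply: leq_trans (leq_card_setU _ _) _; rewrite leq_add2l.
  exact: leq_card_setU.
have := le_trans (gZ _ (QZ w0)) h1.
rewrite -!mulrDl ler_pM2r //.
have r1 := rho_le (eq_leq cZ) (QZ w0).
have [r0 _] := rho_bounds T_gt0 c_gt0 room1 room2 ZL (QZ w0).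
have r2 : rho R k Z (Q w0) ^+ 2 <= (kap + h) ^+ 2.
  by rewrite lerXn2r ?nnegrE; lra.
(* If i and i' differed, (1 - h) kap <= c^2 / 2 + (kap + h)^2 would hold. The difference kap - kap^2
   is at least 16 c^2, while the terms in h amount to at most 4 h <= c^2 / 2. *)
have kk : 16 * c ^+ 2 <= kap * (1 - kap).
  have -> : 16 * c ^+ 2 = (4 * c) * (4 * c) by ring.
  by apply: ler_pM => //; lra.
have hh : h ^+ 2 <= h by rewrite expr2 ler_piMr; lra.
lra.
Qed.

Lemma good_mono (mu mu' : R) (Z : {set T}) : mu <= mu' ->
  good k mu' F Z -> good k mu F Z.
Proof. by move=> hm gZ Q /gZ; apply: le_trans; apply: ler_wpM2r. Qed.

Lemma expr_ge_linear (e : R) m : 0 <= e -> e <= 1 -> 1 - m%:R * e <= (1 - e) ^+ m.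
Proof.
move=> e0 e1; elim: m => [|m IH]; first by rewrite expr0 mul0r subr0.
have e1' : 0 <= 1 - e by lra.
rewrite exprS; apply: le_trans (ler_wpM2l e1' IH).
have : 0 <= m%:R * e * e by rewrite !mulr_ge0.
rewrite -natr1; lra.
Qed.

Hypothesis n_ge4 :
  (2 ^ L)%:R / ((h / (4 * d%:R + 4)) ^+ 2 * c ^+ 2 * c) + (3 * d%:R + 6) <= c * n.
Hypothesis unifF : uniform k F.
Hypothesis denseF : (1 - h / 2) * kap * #|cyl k (@set0 T) set0|%:R <= #|F|%:R.

Lemma star_of_dense : exists i : T, forall A : {set T}, A \in F -> i \in A.
Proof.
have c0 := c_gt0; have c4 := c_le; have h0 := h_gt0; have [hg hdl] := h_le.
have kg := kap_ge; have kl1 := kap_le1; have d0 := d_gt0; have d1 := d_ge1.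
have g2 := gam_le2; have g0 := gam_gt0; have n0 := n_gt0.
have gp : 8 * d%:R * gam <= c ^+ (2 * d + 1) by apply: gam_pow; clear; lia.
have r1 := room1; have r2 := room2; have n4 := n_ge4.
have cc : c ^+ 2 <= c / 4 by rewrite expr2 -[leRHS]mulrC ler_wpM2r //; lra.
(* Each of the two extensions adds d + 1 points and costs a factor P >= 1 - h / 4; with the initial
   loss h / 2 the density stays above (1 - h) kap. *)
pose eta := h / (4 * d%:R + 4).
have eta0 : 0 < eta by rewrite divr_gt0 //; lra.
have etaE : eta * (4 * d%:R + 4) = h by rewrite /eta divfK // gt_eqF //; lra.
have etad : 0 <= eta * d%:R by rewrite mulr_ge0 // ltW.
have eta1 : eta <= 1 by lra.
pose P := (1 - eta) ^+ d.+1.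
have P_ge : 1 - h / 4 <= P.
  apply: le_trans (expr_ge_linear d.+1 (ltW eta0) eta1).
  by rewrite -[d.+1%:R]natr1; lra.
have PP : 1 - h / 2 <= P * P.
  apply: le_trans (_ : (1 - h / 4) * (1 - h / 4) <= _).
    by have := sqr_ge0 (h / 4); lra.
  by apply: ler_pM => //; lra.
have P1 : P <= 1 by apply: exprn_ile1; lra.
have kap0 : 0 < kap :> R by lra.
have lowP : 1 - h <= P * (P * (1 - h / 2)).
  rewrite mulrA; apply: le_trans (_ : (1 - h / 2) * (1 - h / 2) <= _).
    by have := sqr_ge0 (h / 2); lra.
  by apply: ler_wpM2r => //; lra.
have lowP1 : 1 - h <= P * (1 - h / 2).
  apply: le_trans lowP _; rewrite ler_piMl // mulr_ge0 //; lra.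
have ckap : c <= (1 - h) * kap.
  have : h * kap <= (1 / 4) * kap by apply: ler_wpM2r; lra.
  lra.
have good0 : good k ((1 - h / 2) * kap) F set0.
  move=> Q; rewrite subset0 => /eqP ->; apply: le_trans denseF _.
  rewrite ler_nat subset_leq_card //; apply/subsetP => A AF.
  by rewrite in_setI AF in_cyl (unifF AF) eqxx setI0 eqxx.
have PE : P * ((1 - h / 2) * kap) = P * (1 - h / 2) * kap by rewrite !mulrA.
have ckap1 : c <= P * ((1 - h / 2) * kap).
  by apply: le_trans ckap _; rewrite PE; apply: ler_wpM2r lowP1; apply: ltW.
have PPE : P * (P * ((1 - h / 2) * kap)) = P * (P * (1 - h / 2)) * kap.
  by rewrite !mulrA.
have ckap2 : c <= P * (P * ((1 - h / 2) * kap)).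
  by apply: le_trans ckap _; rewrite PPE; apply: ler_wpM2r lowP; apply: ltW.
have [||W [cW _]] := @good_extend R T k L c T_gt0 c_gt0 r1 r2 c
  ((1 - h / 2) * kap) eta F set0 set0 d.+1 c0 eta0 eta1 _ good0 ckap1.
- by rewrite cards0; clear; lia.
- rewrite -/eta in n4; rewrite setU0 setC0 cardsT -[d.+1%:R]natr1.
  have : c * n <= n by rewrite ler_piMl ?ltW //; lra.
  lra.
rewrite set0U -/P => gW.
have gW' : good k ((1 - h) * kap) F W.
  by apply: good_mono gW; rewrite PE; apply: ler_wpM2r lowP1; apply: ltW.
have [w0 w0W] : exists w, w \in W by apply/card_gt0P; rewrite cW.
have [i iW fewW] := good_centre cW gW' w0W.
exists i => B BF; apply/negPn/negP => iB.
have cB : #|B| = k := unifF BF.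
have cav : (#|(i |: B) :|: W| <= k + d + 2)%N.
  apply: leq_trans (leq_card_setU _ _) _; rewrite cW.
  have : (#|i |: B| <= #|[set i]| + #|B|)%N by apply: leq_card_setU.
  by rewrite cards1 cB; clear; lia.
(* W is extended, rather than V built from nothing, because [centre_unique] needs density on W :|:
   V. There is room outside B, i and W since 1 - kap >= 4 c. *)
have [||V [cV dV]] := @good_extend R T k L c T_gt0 c_gt0 r1 r2 c
  (P * ((1 - h / 2) * kap)) eta F W (i |: B) d.+1 c0 eta0 eta1 _ gW ckap2.
- by rewrite cW; clear; lia.
- rewrite cardsCs setCK natrB ?max_card //.
  move: cav; rewrite -(ler_nat R) !natrD => cav.
  rewrite -/eta in n4; rewrite -[d.+1%:R]natr1.
  have := ler_wpM2r (ltW n0) kl1; rewrite mulrBl kap_n => h1.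
  have : 0 < c * n by rewrite mulr_gt0.
  lra.
rewrite -/P => gWV.
have {}gWV : good k ((1 - h) * kap) F (W :|: V).
  by apply: good_mono gWV; rewrite PPE; apply: ler_wpM2r lowP; apply: ltW.
have gV : good k ((1 - h) * kap) F V by apply: good_sub gWV; apply: subsetUr.
have [v0 v0V] : exists v, v \in V by apply/card_gt0P; rewrite cV.
have [i' i'V fewV] := good_centre cV gV v0V.
have avoidV x : x \in V -> [/\ x != i, x \notin B & x \notin W].
  move=> xV; have := disjointFr dV xV; rewrite !inE => /negbT.
  by rewrite !negb_or -andbA => /and3P[].
have iV : i \notin V by apply/negP => /avoidV[]; rewrite eqxx.
have dVW : [disjoint V & W].
  rewrite -setI_eq0; apply/eqP/setP => x; rewrite !inE.
  by apply/negP => /andP[/avoidV[_ _ /negbTE ->]].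
have dBV : [disjoint B & V].
  rewrite -setI_eq0; apply/eqP/setP => x; rewrite !inE.
  by apply/negP => /andP[xB /avoidV[_]]; rewrite xB.
have ii' := centre_unique cW cV dVW gWV w0W v0V iW iV i'V fewW fewV.
rewrite -{}ii' {i' i'V} in fewV.
apply: noF; apply: (@dense_star_simplex R T k L c T_gt0 c_gt0 r1 r2
  d F V B v0 i) => //.
- have kn : (k <= #|T|)%N.
    have cn : 0 < c * n by rewrite mulr_gt0.
    by rewrite -(ler_nat R); lra.
  by rewrite -(ler_nat R) natrM natrB //; have := k_le; lra.
- by rewrite cV; move: d0; clear; lia.
have VL : (#|V| <= L)%N by rewrite cV; clear; lia.
have sV : V :\ v0 \subset V by apply: subD1set.
have C1 := card_cyl_inE T_gt0 c_gt0 r1 r2 VL sV iV.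
have V2 : (#|V| <= 2 * d + 2)%N by rewrite cV; clear; lia.
have rl := rho_le V2 sV.
have [rg _] := rho_bounds T_gt0 c_gt0 r1 r2 VL sV.
have gV0 := gV _ sV.
have C0 : 0 < #|cyl k V (V :\ v0)|%:R :> R.
  by rewrite ltr0n; apply: (card_cyl_gt0 T_gt0 c_gt0 r1 r2).
have split1 : #|cyl k (i |: V) (i |: V :\ v0) :\: F|%:R +
   #|[set B in F :&: cyl k V (V :\ v0) | i \in B]|%:R =
   #|cyl k (i |: V) (i |: V :\ v0)|%:R :> R.
  rewrite -natrD -(cardsID F (cyl k (i |: V) _)) addnC; congr (_ + _)%:R.
  congr #|pred_of_set _|; rewrite cyl_in //; apply/setP => X.
  by rewrite !in_set; case: (X \in F); rewrite /= ?andbT ?andbF.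
have := congr1 (fun a : nat => a%:R : R)
  (card_split_elem (F :&: cyl k V (V :\ v0)) i).
rewrite natrD => split2.
move: split1 split2 C1 gV0 fewV.
move: #|cyl k (i |: V) _ :\: F|%:R #|[set _ in _ | _]|%:R => bad inF.
move: #|[set _ in _ | _]|%:R => outF.
move: #|F :&: _|%:R => tot.
move: #|cyl k (i |: V) _|%:R => C1 split1 split2 C1E gV0 fewV.
rewrite C1E.
move: (rho R k V (V :\ v0)) rl rg C1E => r rl rg C1E.
move: C0 gV0 fewV C1E; move: #|cyl k V (V :\ v0)|%:R => C C0 gV0 fewV C1E.
have kC : h * kap * C <= h * C.
  by rewrite ler_pM2r // ler_piMr ?ltW //; lra.
have rC : r * C <= (kap + h) * C by apply: ler_wpM2r => //; exact: ltW.
have gC : h * C <= gam * C by apply: ler_wpM2r => //; exact: ltW.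
(* Of the r C <= (kap + h) C sets containing i, at least (1 - h) kap C - 2 gam C belong to F, and h
   <= gam. *)
have badC : bad <= 4 * gam * C by lra.
have cp : 0 < c ^+ (2 * d) by apply: exprn_gt0.
have h1 : d%:R * bad <= d%:R * (4 * gam * C) by apply: ler_wpM2l.
have h2 : 8 * d%:R * gam * C <= c ^+ (2 * d + 1) * C.
  by apply: ler_wpM2r => //; exact: ltW.
have h3 : c ^+ (2 * d + 1) * C <= c ^+ (2 * d) * (r * C).
  rewrite exprD expr1 -mulrA; apply: ler_wpM2l; first exact: ltW.
  by apply: ler_wpM2r => //; exact: ltW.
have h4 : 0 < c ^+ (2 * d + 1) * C by rewrite mulr_gt0 // exprn_gt0.
lra.
Qed.

End Star.

(** * Choice of the constants *)

Theorem theorem10p1 (R : realType) (d : nat) (zeta : R)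
    (d_gt0 : (0 < d)%N) (zeta_gt0 : 0 < zeta) :
  exists (eps0 : R) (n0 : nat), 0 < eps0 /\
    forall (n k : nat) (F : {set {set 'I_n}}),
      (n0 < n)%N ->
      zeta * n%:R <= k%:R ->
      k%:R <= (d%:R - 1) / d%:R * n%:R :> R ->
      uniform k F ->
      ~ contains_simplex d F ->
      (1 - eps0) * 'C(n.-1, k.-1)%:R <= #|F|%:R ->
      exists i : 'I_n, forall A : {set 'I_n}, A \in F -> i \in A.
Proof.
have d0 : 0 < d%:R :> R by rewrite ltr0n.
have d10 : 0 < d%:R + 1 :> R by lra.
(* The minimum with zeta gives 4 c n <= k. The minimum with 1 / d keeps 4 c below 1 - k / n and
   makes q - k / n at least 4 v. *)
pose c : R := Num.min zeta d%:R^-1 / 4.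
have c0 : 0 < c by rewrite divr_gt0 // lt_min zeta_gt0 invr_gt0.
have c_zeta : 4 * c <= zeta.
  have : Num.min zeta d%:R^-1 <= zeta by rewrite ge_min lexx.
  by rewrite /c; lra.
have c_d : 4 * c * d%:R <= 1.
  have -> : 4 * c = Num.min zeta d%:R^-1 by rewrite /c mulrC divfK // pnatr_eq0.
  by rewrite -ler_pdivlMr // mul1r ge_min lexx orbT.
pose gam := c ^+ (2 * d + 3) / (8 * d%:R).
pose v := c / (d%:R + 1).
pose del := gam * v / 8.
pose h := gam * del / (48 * d%:R).
have d8 : 0 < 8 * d%:R :> R by lra.
have d48 : 0 < 48 * d%:R :> R by lra.
have gam0 : 0 < gam by apply: divr_gt0 => //; apply: exprn_gt0.
have v0 : 0 < v by rewrite divr_gt0.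
have del0 : 0 < del by apply: divr_gt0 => //; apply: mulr_gt0.
have h0 : 0 < h by apply: divr_gt0 => //; apply: mulr_gt0.
pose b1 := (4 * d + 4)%:R / c.
pose b2 := 4 * (d%:R + 1) / (c * h).
pose b3 := 1 / (4 * c ^+ 2 * h ^+ 3).
pose b4 := ((2 ^ (4 * d + 4))%:R / ((h / (4 * d%:R + 4)) ^+ 2 * c ^+ 2 * c) +
  (3 * d%:R + 6)) / c.
have ch0 : 0 < c * h by apply: mulr_gt0.
have c2h3 : 0 < 4 * c ^+ 2 * h ^+ 3.
  by apply: mulr_gt0; [apply: mulr_gt0 => //|]; apply: exprn_gt0.
have d4 : 0 < 4 * d%:R + 4 :> R by lra.
have den0 : 0 < (h / (4 * d%:R + 4)) ^+ 2 * c ^+ 2 * c.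
  apply: mulr_gt0 => //; apply: mulr_gt0; apply: exprn_gt0 => //.
  exact: divr_gt0.
have b1_ge0 : 0 <= b1 by apply: divr_ge0 => //; apply: ltW.
have b2_ge0 : 0 <= b2.
  by apply: divr_ge0; [apply: mulr_ge0 => //|]; apply: ltW.
have b3_ge0 : 0 <= b3 by apply: divr_ge0 => //; apply: ltW.
have b4_ge0 : 0 <= b4.
  apply: divr_ge0; last exact: ltW.
  by apply: addr_ge0; [apply: divr_ge0 => //; apply: ltW | lra].
(* Each summand solves one of the lower bounds required of n, and all are nonnegative, so their sum
   dominates every one of them. *)
exists (h / 2), (Num.bound (b1 + b2 + b3 + b4)); split; first by rewrite divr_gt0.
move=> n k F hn kge kle unifF noF dens.
have nb : b1 + b2 + b3 + b4 <= n%:R.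
  apply: le_trans (ltW (archi_boundP _)) _; first by rewrite !addr_ge0.
  by rewrite ler_nat ltnW.
have n0 : 0 < n%:R :> R by rewrite ltr0n; apply: leq_trans hn.
have k0 : (0 < k)%N.
  by rewrite -(ltr0n R); apply: lt_le_trans kge; rewrite mulr_gt0.
apply: (@star_of_dense R 'I_n d k F c gam v del h) => //; rewrite ?card_ord.
- by rewrite -(ltr0n R).
- by apply: le_trans kge; rewrite ler_pM2r.
- have := ler_wpM2l (ltW d0) kle.
  by rewrite mulrA [d%:R * (_ / _)]mulrC divfK // gt_eqF.
- by rewrite /gam divfK // gt_eqF.
- by rewrite /v divfK // gt_eqF.
- by rewrite /del divfK // pnatr_eq0.
- by rewrite /h divfK // gt_eqF.
- by rewrite [leRHS]mulrC -ler_pdivrMr // -/b1; lra.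
- by rewrite [leRHS]mulrC -ler_pdivrMr // -/b2; lra.
- by rewrite [leRHS]mulrC -ler_pdivrMr // -/b3; lra.
- by rewrite [leRHS]mulrC -ler_pdivrMr // -/b4; lra.
have -> : #|cyl k (@set0 'I_n) set0| = 'C(n, k).
  by rewrite card_cyl ?sub0set ?cards0 // !subn0 card_ord.
have e : k%:R / n%:R * 'C(n, k)%:R = 'C(n.-1, k.-1)%:R :> R.
  have := mul_bin_diag n k.-1; rewrite prednK // => /(congr1 (fun a => a%:R : R)).
  rewrite !natrM => e; rewrite mulrAC -e mulrAC mulfV ?mul1r // gt_eqF //.
by rewrite -mulrA e.
Qed.
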